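(* Let $0\leq\alpha<1$ and let $f(z)=z+a_2z^2+a_3z^3+\cdots$ belong to the class $\mathcal{S}^{\star}(\alpha)$. Then $$|H_2(2)|=|a_2a_4-a_3^2|\leq(1-\alpha)^2,$$ and this estimate is sharp: for each $\alpha\in[0,1)$ the constant $(1-\alpha)^2$ is the best possible bound valid for all $f\in\mathcal{S}^{\star}(\alpha)$.
   Context: Let $\mathbb{D}=\{z\in\mathbb{C}:|z|<1\}$ and let $\mathcal{A}$ be the family of all functions $f$ analytic in $\mathbb{D}$ with $f(0)=0$ and $f'(0)=1$, so that $f(z)=z+a_2z^2+a_3z^3+\cdots$ in $\mathbb{D}$. For $f\in\mathcal{A}$ the second Hankel determinant is $H_2(2)=a_2a_4-a_3^2$. For $0\leq\alpha<1$, the class $\mathcal{S}^{\star}(\alpha)$ of starlike functions of order $\alpha$ consists of all $f\in\mathcal{A}$ such that $\operatorname{Re}\left[\frac{zf'(z)}{f(z)}\right]>\alpha$ for all $z\in\mathbb{D}$ (here the quotient $zf'(z)/f(z)$ is understood to be analytic in $\mathbb{D}$, i.e. $f(z)\neq0$ for $z\in\mathbb{D}\setminus\{0\}$, with value $1$ at $z=0$). *)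

(* Defs.v *)
From Stdlib Require Import Reals.
From Coquelicot Require Import Coquelicot.
Open Scope R_scope.

Definition unit_disk (z : C) : Prop := Cmod z < 1.

(* Functions on the disk are total functions [C -> C]; values outside the
   disk are never constrained. *)
Definition analytic_in_disk (f : C -> C) : Prop :=
  forall z : C, unit_disk z -> ex_derive f z.

(* The family of normalized analytic functions, usually written [A]. *)
Definition normalized_analytic (f : C -> C) : Prop :=
  analytic_in_disk f /\ f (RtoC 0) = RtoC 0 /\ C_derive f (RtoC 0) = RtoC 1.

(* [z f'(z) / f(z)], with its removable singularity at the origin filled in by
   its limit (namely 1 when [f] is normalized). *)
Definition starlike_quotient (f : C -> C) (z : C) : C :=
  if Ceq_dec z (RtoC 0) then RtoC 1 else (z * C_derive f z / f z)%C.

(* Nonvanishing off the origin makes the quotient analytic in the disk; it has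
   to be required separately since division by zero is total here. *)
Definition starlike_of_order (alpha : R) (f : C -> C) : Prop :=
  normalized_analytic f /\
  (forall z : C, unit_disk z -> z <> RtoC 0 -> f z <> RtoC 0) /\
  (forall z : C, unit_disk z -> alpha < Re (starlike_quotient f z)).

(* [f z = a 0 + a 1 z + a 2 z^2 + ...] throughout the disk.  By Taylor's
   theorem such an [a] exists and is unique for every analytic [f]; when [f] is
   normalized, [a 0 = 0] and [a 1 = 1]. *)
Definition taylor_coefficients (f : C -> C) (a : nat -> C) : Prop :=
  forall z : C, unit_disk z -> is_pseries a z (f z).

(* The second Hankel determinant [H_2(2)]. *)
Definition hankel_2_2 (a : nat -> C) : C :=
  (a 2%nat * a 4%nat - a 3%nat ^ 2)%C.

(* Main.v *)
Require Import Defs.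
From Stdlib Require Import Reals Lra Lia Classical IndefiniteDescription.
From Coquelicot Require Import Coquelicot.
Open Scope R_scope.

(** Write [beta = 1 - alpha] and [p = z f' / f].  Since [Re p > alpha], the
    function [w = (p - 1) / (p + 1 - 2 alpha)] maps the disk into itself and
    vanishes at the origin: [w = w1 z + w2 z^2 + w3 z^3 + ...].  Comparing
    coefficients in [p - 1 = w (p + 1 - 2 alpha)] expresses [a2, a3, a4] through
    [w1, w2, w3] and gives

      [3 H_2(2) = beta^2 (4 w1 w3 - 3 w2^2 + 2 w1^2 w2 + (1 - 4 beta^2) w1^4)].

    Schur's algorithm writes [w2 = (1 - |w1|^2) x] and
    [w3 = (1 - |w1|^2) ((1 - |x|^2) zeta - conj w1 x^2)] with [|x|, |zeta| <= 1]
    ([schur_parameters]), after which the triangle inequality bounds the bracket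
    by [3] ([schur_functional_bound]).  Equality holds for
    [f = z / (1 - z^2)^beta], where [a2 = 0] and [a3 = beta]
    ([extremal_function]).

    Schur's algorithm rests on the Schwarz lemma, hence on the maximum principle
    for [w] and its iterates.  No Cauchy integral is used: all these functions
    are quotients of power series convergent in the disk, and such quotients can
    be divided by [z - z0] at every point ([taylor_divide], [quotient_divide]).
    They therefore have second-order expansions everywhere, and a second-order
    expansion is enough to exclude interior maxima of [|w|^2 + eps |z|^2]
    ([quotient_no_interior_max]).  The algorithm is run on pairs numerator and
    denominator, never on the quotient itself ([schur_step]); it needs
    [|w| <= t < 1], so it is applied to [t w], and [t] tends to one at the
    end. *)

(** * Power series on the unit disk *)

Definition partial_sum (a : nat -> C) (z : C) (n : nat) : C :=
  sum_n (fun k => (a k * z ^ k)%C) n.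

Lemma partial_sum_0 a z : partial_sum a z 0 = a 0%nat.
Proof. unfold partial_sum. rewrite sum_O. simpl. ring. Qed.

Lemma partial_sum_S a z n :
  partial_sum a z (S n) = (partial_sum a z n + a (S n) * z ^ S n)%C.
Proof. unfold partial_sum. now rewrite sum_Sn. Qed.

Lemma Cseq_lim_iff (u : nat -> C) (l : C) :
  @filterlim nat C_NormedModule u eventually (locally l) <->
  is_lim_seq (fun n => Cmod (u n - l)) 0.
Proof.
  rewrite filterlim_locally_ball_norm.
  split.
  - intros H. apply is_lim_seq_spec. intros eps. generalize (H eps).
    apply filter_imp. intros n Hn. unfold ball_norm in Hn.
    change (Cmod (u n - l) < eps) in Hn.
    rewrite Rminus_0_r, Rabs_pos_eq; auto using Cmod_ge_0.
  - intros H. apply is_lim_seq_spec in H. intros eps. generalize (H eps).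
    apply filter_imp. intros n Hn. change (Cmod (u n - l) < eps).
    rewrite Rminus_0_r, Rabs_pos_eq in Hn; auto using Cmod_ge_0.
Qed.

Lemma is_pseries_iff (a : nat -> C) (z l : C) :
  is_pseries a z l <-> is_lim_seq (fun n => Cmod (partial_sum a z n - l)) 0.
Proof.
  rewrite <- Cseq_lim_iff. unfold is_pseries, is_series.
  split; apply filterlim_ext; intros n; apply sum_n_ext; intros k;
    change (@eq C (pow_n z k * a k)%C (a k * z ^ k)%C) ||
    change (@eq C (a k * z ^ k)%C (pow_n z k * a k)%C);
    change (pow_n z k) with (z ^ k)%C; ring.
Qed.

Lemma is_lim_seq_squeeze_0 (u v : nat -> R) :
  (forall n, 0 <= u n <= v n) -> is_lim_seq v 0 -> is_lim_seq u 0.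
Proof.
  intros H Hv. apply is_lim_seq_le_le with (fun _ => 0) v; auto.
  apply is_lim_seq_const.
Qed.

Lemma is_pseries_C_unique (a : nat -> C) (z l l' : C) :
  is_pseries a z l -> is_pseries a z l' -> l = l'.
Proof.
  intros H H'. exact (filterlim_locally_unique _ _ _ H H').
Qed.

(** Equivalent to convergence in the whole disk, but stated on coefficients, so
    that it passes to shifts, multiples and tails of the sequence. *)
Definition subexponential (a : nat -> C) : Prop :=
  forall r, 0 < r < 1 -> exists K, forall n, Cmod (a n) * r ^ n <= K.

Lemma taylor_subexponential f a :
  taylor_coefficients f a -> subexponential a.
Proof.
  intros H r Hr.
  assert (Hd : unit_disk (RtoC r)).
  { unfold unit_disk. rewrite Cmod_R, Rabs_pos_eq; lra. }
  specialize (H _ Hd). apply is_pseries_iff, Cseq_lim_iff in H.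
  destruct (filterlim_bounded (V := C_NormedModule) _
    (ex_intro (fun l => filterlim _ _ (locally l)) _ H)) as [M HM].
  change (forall n, Cmod (partial_sum a (RtoC r) n) <= M) in HM.
  exists (M + M). intros n.
  assert (HM0 := Rle_trans _ _ _ (Cmod_ge_0 _) (HM 0%nat)).
  assert (Hn : Cmod (a n) * r ^ n = Cmod (a n * RtoC r ^ n)).
  { rewrite Cmod_mult, Cmod_pow, Cmod_R, (Rabs_pos_eq r) by lra. reflexivity. }
  rewrite Hn. destruct n as [|n].
  - specialize (HM 0%nat). rewrite partial_sum_0 in HM.
    simpl. rewrite Cmult_1_r. lra.
  - replace (a (S n) * RtoC r ^ S n)%C
      with (partial_sum a r (S n) + - partial_sum a r n)%C
      by (rewrite partial_sum_S; ring).
    eapply Rle_trans; [apply Cmod_triangle|]. rewrite Cmod_opp.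
    apply Rplus_le_compat; apply HM.
Qed.

Lemma sum_geom_le q n : 0 <= q < 1 -> sum_n (fun k => q ^ k) n <= / (1 - q).
Proof.
  intros Hq. rewrite sum_n_Reals, tech3 by lra.
  assert (0 <= q ^ S n) by (apply pow_le; lra).
  apply Rmult_le_reg_r with (1 - q); [lra|].
  unfold Rdiv. rewrite Rmult_assoc, Rinv_l by lra. nra.
Qed.

Lemma Cmod_partial_sum_le a z n :
  Cmod (partial_sum a z n) <= sum_n (fun k => Cmod (a k) * Cmod z ^ k) n.
Proof.
  induction n as [|n IH].
  - rewrite partial_sum_0, sum_O. simpl. lra.
  - rewrite partial_sum_S, sum_Sn. eapply Rle_trans; [apply Cmod_triangle|].
    rewrite Cmod_mult, Cmod_pow. apply Rplus_le_compat_r, IH.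
Qed.

Lemma Cmod_lim_le (u : nat -> C) (l : C) (M : R) :
  is_lim_seq (fun n => Cmod (u n - l)) 0 -> (forall n, Cmod (u n) <= M) ->
  Cmod l <= M.
Proof.
  intros H HM.
  assert (L : is_lim_seq (fun n => Cmod (u n - l) + M) (0 + M)).
  { apply is_lim_seq_plus'; [exact H|apply is_lim_seq_const]. }
  assert (L' : Rbar_le (Cmod l) (0 + M)).
  { apply (is_lim_seq_le (fun _ => Cmod l) _ _ _) with (2 := is_lim_seq_const _)
      (3 := L).
    intros n. replace l with (- (u n - l) + u n)%C at 1 by ring.
    eapply Rle_trans; [apply Cmod_triangle|]. rewrite Cmod_opp.
    apply Rplus_le_compat_l, HM. }
  simpl in L'. lra.
Qed.

(** The ratio is [q = rho / r] for any [r] strictly between [rho] and one. *)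
Lemma subexponential_geom a rho :
  subexponential a -> 0 <= rho < 1 ->
  exists K q, 0 <= K /\ 0 <= q < 1 /\
    forall n, Cmod (a n) * rho ^ n <= K * q ^ n.
Proof.
  intros Ha Hr. set (r := (1 + rho) / 2).
  assert (Hr' : 0 < r < 1 /\ rho < r) by (unfold r; lra).
  destruct (Ha r (proj1 Hr')) as [K HK].
  exists K, (rho / r). repeat split.
  - eapply Rle_trans; [|apply (HK 0%nat)].
    apply Rmult_le_pos; [apply Cmod_ge_0|simpl; lra].
  - apply Rdiv_le_0_compat; lra.
  - apply Rlt_div_l; lra.
  - intros n. replace rho with (r * (rho / r)) at 1 by (field; lra).
    rewrite Rpow_mult_distr, <- Rmult_assoc.
    apply Rmult_le_compat_r; [|apply HK].
    apply pow_le, Rdiv_le_0_compat; lra.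
Qed.

Lemma pseries_bound a rho :
  subexponential a -> 0 <= rho < 1 ->
  exists K, forall z l, Cmod z <= rho -> is_pseries a z l -> Cmod l <= K.
Proof.
  intros Ha Hr. destruct (subexponential_geom a rho Ha Hr) as (K & q & HK & Hq & H).
  exists (K * / (1 - q)). intros z l Hz Hl.
  apply is_pseries_iff in Hl. apply Cmod_lim_le with (1 := Hl). intros n.
  eapply Rle_trans; [apply Cmod_partial_sum_le|].
  eapply Rle_trans; [|apply Rmult_le_compat_l, (sum_geom_le q n Hq); auto].
  rewrite <- (sum_n_mult_l (K := R_Ring) K).
  rewrite !sum_n_Reals. apply sum_Rle. intros k _.
  eapply Rle_trans; [|apply H].
  apply Rmult_le_compat_l; [apply Cmod_ge_0|].
  apply pow_incr. split; [apply Cmod_ge_0|auto].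
Qed.

(** Absolute convergence of the real and imaginary parts. *)
Lemma subexponential_ex_pseries a z :
  subexponential a -> unit_disk z -> exists l, is_pseries a z l.
Proof.
  intros Ha Hz. unfold unit_disk in Hz.
  assert (Hz0 : 0 <= Cmod z < 1) by (split; [apply Cmod_ge_0|auto]).
  destruct (subexponential_geom a _ Ha Hz0) as (K & q & HK & Hq & H).
  assert (G : ex_series (fun n => K * q ^ n)).
  { apply (ex_series_scal (V := R_NormedModule) K). apply ex_series_geom.
    rewrite Rabs_pos_eq; lra. }
  assert (Hc : forall n, Cmod (a n * z ^ n) <= K * q ^ n).
  { intros n. rewrite Cmod_mult, Cmod_pow. apply H. }
  destruct (ex_series_le (V := R_CompleteNormedModule)
    (fun n => fst (a n * z ^ n)%C) _
    (fun n => Rle_trans _ _ _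
      (Rle_trans _ _ _ (Rmax_l _ _) (Rmax_Cmod (a n * z ^ n)%C)) (Hc n)) G)
    as [x Hx].
  destruct (ex_series_le (V := R_CompleteNormedModule)
    (fun n => snd (a n * z ^ n)%C) _
    (fun n => Rle_trans _ _ _
      (Rle_trans _ _ _ (Rmax_r _ _) (Rmax_Cmod (a n * z ^ n)%C)) (Hc n)) G)
    as [y Hy].
  exists (x, y). apply is_pseries_iff.
  assert (Hp : forall n, partial_sum a z n =
    (sum_n (fun n => fst (a n * z ^ n)%C) n, sum_n (fun n => snd (a n * z ^ n)%C) n)).
  { induction n as [|n IH].
    - rewrite partial_sum_0, !sum_O.
      replace (a 0%nat * z ^ 0)%C with (a 0%nat) by (simpl; ring).
      apply surjective_pairing.
    - rewrite partial_sum_S, IH, !sum_Sn. now destruct (a (S n) * z ^ S n)%C. }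
  assert (L : is_lim_seq (fun n =>
     Rabs (sum_n (fun n => fst (a n * z ^ n)%C) n - x) +
     Rabs (sum_n (fun n => snd (a n * z ^ n)%C) n - y)) (0 + 0)).
  { assert (E : forall (u : nat -> R) l, is_series u l ->
      is_lim_seq (fun n => Rabs (sum_n u n - l)) 0).
    { intros u l Hu. change (is_lim_seq (sum_n u) l) in Hu.
      apply (is_lim_seq_abs_0 (fun n => sum_n u n - l)).
      replace 0 with (l - l) by ring.
      apply is_lim_seq_minus'; [auto|apply is_lim_seq_const]. }
    apply is_lim_seq_plus'; apply E; auto. }
  rewrite Rplus_0_r in L. revert L. apply is_lim_seq_squeeze_0.
  intros n. split; [apply Cmod_ge_0|]. rewrite Hp.
  set (u := sum_n _ n). set (v := sum_n _ n).
  replace ((u, v) - (x, y))%C with (RtoC (u - x) + Ci * RtoC (v - y))%C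
    by (apply injective_projections; simpl; ring).
  eapply Rle_trans; [apply Cmod_triangle|].
  rewrite Cmod_mult, Cmod_Ci, !Cmod_R. lra.
Qed.

Lemma subexponential_taylor a :
  subexponential a -> exists f, taylor_coefficients f a.
Proof.
  intros Ha.
  destruct (functional_choice (fun z l => unit_disk z -> is_pseries a z l))
    as [f Hf]; [|exists f; exact Hf].
  intros z. destruct (Rlt_dec (Cmod z) 1) as [Hz|Hz].
  - destruct (subexponential_ex_pseries a z Ha Hz) as [l Hl]. now exists l.
  - exists (RtoC 0). intros H. contradiction.
Qed.

Lemma partial_sum_shift a z n :
  partial_sum a z (S n) = (a 0%nat + z * partial_sum (fun k => a (S k)) z n)%C.
Proof.
  induction n as [|n IH].
  - rewrite partial_sum_S, !partial_sum_0. simpl. ring.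
  - rewrite partial_sum_S, IH, partial_sum_S. simpl. ring.
Qed.

Lemma is_pseries_cons a (z l : C) :
  is_pseries (fun k => a (S k)) z l -> is_pseries a z (a 0%nat + z * l)%C.
Proof.
  rewrite !is_pseries_iff. intros H. apply is_lim_seq_incr_1.
  apply (is_lim_seq_scal_l _ (Cmod z)) in H. simpl in H.
  rewrite Rmult_0_r in H. revert H. apply is_lim_seq_ext. intros n.
  rewrite <- Cmod_mult. f_equal. rewrite partial_sum_shift. ring.
Qed.

Lemma is_pseries_lin a b (c z la lb : C) :
  is_pseries a z la -> is_pseries b z lb ->
  is_pseries (fun n => (a n + c * b n)%C) z (la + c * lb)%C.
Proof.
  intros Ha Hb.
  exact (is_pseries_plus (V := C_NormedModule) _ _ _ _ _ Ha
    (is_pseries_scal (V := C_NormedModule) c _ _ _ (Cmult_comm _ _) Hb)).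
Qed.

Lemma taylor_lin f g a b (c : C) :
  taylor_coefficients f a -> taylor_coefficients g b ->
  taylor_coefficients (fun z => f z + c * g z)%C (fun n => a n + c * b n)%C.
Proof. intros Hf Hg z Hz. apply is_pseries_lin; auto. Qed.

Lemma unit_disk_0 : unit_disk (RtoC 0).
Proof. unfold unit_disk. rewrite Cmod_0. lra. Qed.

Lemma taylor_at_0 f a : taylor_coefficients f a -> f (RtoC 0) = a 0%nat.
Proof.
  intros H. apply is_pseries_C_unique with a (RtoC 0); [apply H, unit_disk_0|].
  apply is_pseries_iff. apply is_lim_seq_ext with (fun _ => 0);
    [|apply is_lim_seq_const].
  intros n. destruct n.
  - rewrite partial_sum_0. replace (a 0%nat - a 0%nat)%C with (RtoC 0) by ring.
    now rewrite Cmod_0.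
  - rewrite partial_sum_shift.
    replace (a 0%nat + 0 * partial_sum (fun k : nat => a (S k)) 0 n - a 0%nat)%C
      with (RtoC 0) by ring.
    now rewrite Cmod_0.
Qed.

Lemma subexponential_le a b :
  (forall n, Cmod (b n) <= Cmod (a n)) -> subexponential a -> subexponential b.
Proof.
  intros H Ha r Hr. destruct (Ha r Hr) as [K HK]. exists K. intros n.
  eapply Rle_trans; [|apply (HK n)]. apply Rmult_le_compat_r; auto.
  apply pow_le; lra.
Qed.

Lemma subexponential_shift a m :
  subexponential a -> subexponential (fun n => a (m + n)%nat).
Proof.
  intros Ha r Hr. destruct (Ha r Hr) as [K HK]. exists (K / r ^ m). intros n.
  apply (Rle_div_r _ _ (r ^ m)); [apply pow_lt; lra|].
  rewrite Rmult_assoc, <- pow_add, (Nat.add_comm n). apply HK.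
Qed.

Lemma INR_pow_le q n : 0 <= q < 1 -> INR n * q ^ n <= / (1 - q).
Proof.
  intros Hq. eapply Rle_trans; [|apply (sum_geom_le q n Hq)].
  assert (Hle : forall m, (m <= n)%nat -> q ^ n <= q ^ m).
  { intros m Hm. replace n with (m + (n - m))%nat by lia. rewrite pow_add.
    rewrite <- (Rmult_1_r (q ^ m)) at 2. apply Rmult_le_compat_l.
    - apply pow_le; lra.
    - rewrite <- (pow1 (n - m)). apply pow_incr. lra. }
  rewrite sum_n_Reals.
  apply Rle_trans with (sum_f_R0 (fun _ => q ^ n) n).
  - rewrite sum_cte, S_INR. assert (0 <= q ^ n) by (apply pow_le; lra). lra.
  - apply sum_Rle. intros m Hm. apply Hle; auto.
Qed.

Lemma subexponential_INR a :
  subexponential a -> subexponential (fun n => (RtoC (INR n) * a n)%C).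
Proof.
  intros Ha r Hr.
  destruct (subexponential_geom a r Ha) as (K & q & HK & Hq & H); [lra|].
  exists (K * / (1 - q)). intros n.
  rewrite Cmod_mult, Cmod_R, (Rabs_pos_eq (INR n)) by apply pos_INR.
  apply Rle_trans with (K * (INR n * q ^ n)).
  - specialize (H n). assert (Hn := pos_INR n). nra.
  - apply Rmult_le_compat_l; auto. now apply INR_pow_le.
Qed.

Lemma subexponential_lim_0 a z :
  subexponential a -> unit_disk z -> is_lim_seq (fun n => Cmod (a n * z ^ n)) 0.
Proof.
  intros Ha Hz.
  destruct (subexponential_geom a (Cmod z) Ha) as (K & q & HK & Hq & H).
  { split; [apply Cmod_ge_0|exact Hz]. }
  apply is_lim_seq_squeeze_0 with (fun n => K * q ^ n).
  - intros n. split; [apply Cmod_ge_0|]. rewrite Cmod_mult, Cmod_pow. apply H.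
  - replace 0 with (K * 0) by ring.
    apply (is_lim_seq_scal_l _ K 0), is_lim_seq_geom. rewrite Rabs_pos_eq; lra.
Qed.

(** The coefficients of [(f z - f z0) / (z - z0)] are the tails
    [sum_k a_(m+1+k) z0^k], and tails of a geometrically bounded sequence are
    geometrically bounded. *)
Lemma tails_exist f a z0 :
  taylor_coefficients f a -> unit_disk z0 ->
  exists c : nat -> C, c 0%nat = f z0 /\
    (forall m, c m = (a m + z0 * c (S m))%C) /\ subexponential c.
Proof.
  intros Hf Hz0. assert (Ha := taylor_subexponential f a Hf).
  destruct (functional_choice (fun m l => is_pseries (fun k => a (m + k)%nat) z0 l))
    as [c Hc].
  { intros m. apply subexponential_ex_pseries; auto. now apply subexponential_shift. }
  exists c. repeat split.
  - apply is_pseries_C_unique with a z0; auto. apply (Hc 0%nat).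
  - intros m. apply is_pseries_C_unique with (fun k => a (m + k)%nat) z0; auto.
    assert (E := is_pseries_cons (fun k => a (m + k)%nat) z0 (c (S m))).
    cbv beta in E. rewrite Nat.add_0_r in E. apply E.
    generalize (Hc (S m)). rewrite !is_pseries_iff. apply is_lim_seq_ext.
    intros n. do 2 f_equal. unfold partial_sum. apply sum_n_ext. intros k.
    now rewrite Nat.add_succ_r.
  - intros r Hr. unfold unit_disk in Hz0.
    (* a radius exceeding both [r] and [|z0|] *)
    set (s := Rmax r ((1 + Cmod z0) / 2)).
    assert (Hz := Cmod_ge_0 z0).
    assert (Hs : 0 < s < 1 /\ r <= s /\ Cmod z0 < s).
    { assert (H1 := Rmax_l r ((1 + Cmod z0) / 2)).
      assert (H2 := Rmax_r r ((1 + Cmod z0) / 2)).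
      assert (H3 : s < 1) by (apply Rmax_lub_lt; lra). fold s in H1, H2. lra. }
    destruct Hs as (Hs & Hrs & Hzs).
    destruct (Ha s Hs) as [K HK].
    assert (Hq : 0 <= Cmod z0 / s < 1).
    { split; [apply Rdiv_le_0_compat; lra|apply Rlt_div_l; lra]. }
    exists (K * / (1 - Cmod z0 / s)). intros m.
    assert (Hrm : 0 <= r ^ m <= s ^ m).
    { split; [apply pow_le; lra|apply pow_incr; lra]. }
    apply Rle_trans with (Cmod (c m) * s ^ m).
    { apply Rmult_le_compat_l; [apply Cmod_ge_0|lra]. }
    assert (Hsm : 0 < s ^ m) by (apply pow_lt; lra).
    apply (Rle_div_r _ _ _ Hsm).
    specialize (Hc m). apply is_pseries_iff in Hc.
    apply Cmod_lim_le with (1 := Hc). intros n.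
    eapply Rle_trans; [apply Cmod_partial_sum_le|].
    apply (Rle_div_r _ _ _ Hsm).
    assert (HK0 : 0 <= K).
    { eapply Rle_trans; [|apply (HK 0%nat)].
      apply Rmult_le_pos; [apply Cmod_ge_0|simpl; lra]. }
    eapply Rle_trans; [|apply Rmult_le_compat_l, (sum_geom_le _ n Hq); auto].
    rewrite Rmult_comm, <- !(sum_n_mult_l (K := R_Ring)).
    rewrite !sum_n_Reals. apply sum_Rle. intros k _.
    change (s ^ m * (Cmod (a (m + k)%nat) * Cmod z0 ^ k) <= K * (Cmod z0 / s) ^ k).
    replace (Cmod z0) with (s * (Cmod z0 / s)) at 1 by (field; lra).
    rewrite Rpow_mult_distr.
    replace (s ^ m * (Cmod (a (m + k)%nat) * (s ^ k * (Cmod z0 / s) ^ k)))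
      with (Cmod (a (m + k)%nat) * s ^ (m + k) * (Cmod z0 / s) ^ k)
      by (rewrite pow_add; ring).
    apply Rmult_le_compat_r; [apply pow_le; lra|apply HK].
Qed.

(** Division by [z - z0] stays inside the convergent power series.  Iterating
    it yields Taylor expansions at [z0] of any order, hence differentiability,
    without ever re-expanding a series at [z0]. *)
Lemma taylor_divide f a z0 :
  taylor_coefficients f a -> unit_disk z0 ->
  exists g b, taylor_coefficients g b /\
    (forall z, unit_disk z -> f z = (f z0 + (z - z0) * g z)%C) /\
    is_pseries (fun n => RtoC (INR (S n)) * a (S n))%C z0 (g z0).
Proof.
  intros Hf Hz0.
  destruct (tails_exist f a z0 Hf Hz0) as (c & Hc0 & Hc & Hcs).
  assert (Hb := subexponential_shift c 1 Hcs).
  change (subexponential (fun n => c (S n))) in Hb.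
  destruct (subexponential_taylor _ Hb) as [g Hg].
  exists g, (fun n => c (S n)). split; [exact Hg|]. split.
  - intros z Hz.
    assert (Hl : is_pseries a z (f z0 + (z - z0) * g z)%C).
    { generalize (Hg z Hz). rewrite !is_pseries_iff. intros H.
      apply (is_lim_seq_scal_l _ (Cmod (z - z0))) in H. simpl in H.
      rewrite Rmult_0_r in H.
      (* partial sums of [(z - z0) g] and [f - f z0] differ by one tail term *)
      assert (H' := is_lim_seq_plus' _ _ _ _ H
        (proj1 (is_lim_seq_incr_1 _ _) (subexponential_lim_0 c z Hcs Hz))).
      rewrite Rplus_0_r in H'. revert H'. apply is_lim_seq_squeeze_0.
      intros n. split; [apply Cmod_ge_0|].
      rewrite <- Cmod_mult, <- (Cmod_opp (c (S n) * z ^ S n)).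
      eapply Rle_trans; [|apply Cmod_triangle]. right. f_equal.
      induction n as [|n IH].
      - rewrite !partial_sum_0, <- Hc0, (Hc 0%nat). simpl. ring.
      - rewrite !partial_sum_S.
        transitivity (partial_sum a z n - (f z0 + (z - z0) * g z) + a (S n) * z ^ S n)%C;
          [ring|]. rewrite IH, (Hc (S n)). simpl. ring. }
    apply is_pseries_C_unique with a z; auto.
  - generalize (Hg z0 Hz0). rewrite !is_pseries_iff. intros H.
    assert (Hn := subexponential_lim_0 _ z0 (subexponential_INR _ Hb) Hz0).
    apply is_lim_seq_incr_1 in Hn.
    assert (H' := is_lim_seq_plus' _ _ _ _ H Hn).
    rewrite Rplus_0_r in H'. revert H'. apply is_lim_seq_squeeze_0.
    intros n. split; [apply Cmod_ge_0|].
    rewrite <- (Cmod_opp (RtoC (INR (S n)) * _ * _)).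
    eapply Rle_trans; [|apply Cmod_triangle]. right. f_equal.
    (* summation by parts, [a_(m+1) z0^m] being a difference of consecutive
       terms of the series of [g] *)
    induction n as [|n IH].
    + rewrite !partial_sum_0, (Hc 1%nat). simpl. ring.
    + rewrite !partial_sum_S.
      set (d := (RtoC (INR (S (S n))) * a (S (S n)) * z0 ^ S n)%C).
      transitivity (partial_sum (fun n => RtoC (INR (S n)) * a (S n))%C z0 n
        - g z0 + d)%C; [unfold d; ring|].
      rewrite IH. unfold d. rewrite (Hc (S (S n))), (S_INR (S n)), RtoC_plus.
      simpl. ring.
Qed.

Lemma unit_disk_nbhd z0 z :
  unit_disk z0 -> Cmod (z - z0) < (1 - Cmod z0) / 2 ->
  Cmod z <= (1 + Cmod z0) / 2.
Proof.
  intros H0 H. replace z with ((z - z0) + z0)%C by ring.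
  eapply Rle_trans; [apply Cmod_triangle|]. lra.
Qed.

Lemma taylor_local_bound f a z0 :
  taylor_coefficients f a -> unit_disk z0 ->
  exists K d, 0 <= K /\ 0 < d /\
    forall z, Cmod (z - z0) < d -> unit_disk z /\ Cmod (f z) <= K.
Proof.
  intros Hf Hz0. assert (H0 := Cmod_ge_0 z0). assert (H1 := Hz0).
  unfold unit_disk in H1.
  destruct (pseries_bound a ((1 + Cmod z0) / 2) (taylor_subexponential f a Hf))
    as [K HK]; [lra|].
  assert (H : forall z, Cmod (z - z0) < (1 - Cmod z0) / 2 ->
    unit_disk z /\ Cmod (f z) <= K).
  { intros z Hz. assert (Hn := unit_disk_nbhd z0 z Hz0 Hz).
    assert (unit_disk z) by (unfold unit_disk; lra).
    split; auto. apply HK with z; auto. }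
  exists K, ((1 - Cmod z0) / 2). split; [|split; [lra|exact H]].
  apply Rle_trans with (Cmod (f z0)); [apply Cmod_ge_0|]. apply H.
  replace (z0 - z0)%C with (RtoC 0) by ring. rewrite Cmod_0. lra.
Qed.

(** Two divisions give [f z = f z0 + (z - z0) g z0 + (z - z0)^2 h z] with [h]
    bounded near [z0]. *)
Lemma taylor_is_derive f a z0 :
  taylor_coefficients f a -> unit_disk z0 ->
  exists l, is_derive f z0 l /\
    is_pseries (fun n => RtoC (INR (S n)) * a (S n))%C z0 l.
Proof.
  intros Hf Hz0.
  destruct (taylor_divide f a z0 Hf Hz0) as (g & b & Hg & Hfg & Hl).
  destruct (taylor_divide g b z0 Hg Hz0) as (h & c & Hh & Hgh & _).
  destruct (taylor_local_bound h c z0 Hh Hz0) as (K & d & HK & Hd & Hb).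
  exists (g z0). split; [|exact Hl]. split.
  - apply is_linear_scal_l.
  - intros x Hx. apply (is_filter_lim_locally_unique (V := AbsRing_NormedModule C_AbsRing)) in Hx. subst x.
    intros eps. apply (locally_le_locally_norm (V := AbsRing_NormedModule C_AbsRing)).
    assert (Hd' : 0 < Rmin d (eps / (K + 1))).
    { apply Rmin_pos; auto. apply Rdiv_lt_0_compat; [apply eps|lra]. }
    exists (mkposreal _ Hd'). intros z Hz.
    change (Cmod (z - z0) < Rmin d (eps / (K + 1))) in Hz.
    change (Cmod ((f z - f z0) - (z - z0) * g z0) <= eps * Cmod (z - z0)).
    destruct (Hb z) as [Hzd HKz].
    { eapply Rlt_le_trans; [exact Hz|apply Rmin_l]. }
    rewrite (Hfg z Hzd), (Hgh z Hzd).
    replace (f z0 + (z - z0) * (g z0 + (z - z0) * h z) - f z0 - (z - z0) * g z0)%C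
      with ((z - z0) * h z * (z - z0))%C by ring.
    rewrite !Cmod_mult. apply Rmult_le_compat_r; [apply Cmod_ge_0|].
    assert (H1 := Rlt_le_trans _ _ _ Hz (Rmin_r _ _)).
    apply Rlt_div_r in H1; [|lra].
    assert (H2 := Cmod_ge_0 (z - z0)). nra.
Qed.

Lemma taylor_C_derive f a :
  taylor_coefficients f a ->
  taylor_coefficients (C_derive f) (fun n => RtoC (INR (S n)) * a (S n))%C.
Proof.
  intros Hf z Hz. destruct (taylor_is_derive f a z Hf Hz) as (l & Hd & Hl).
  now rewrite (is_C_derive_unique f z l Hd).
Qed.

(** * Quotients of power series and the maximum principle *)

(** Quotients are closed under the operation [phi |-> (phi - phi z0) / (z - z0)]
    for reasons that only involve numerators, so they can be expanded at every
    point of the disk although no power series at the origin is known for them. *)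
Definition disk_quotient (phi : C -> C) : Prop :=
  exists f a g b, taylor_coefficients f a /\ taylor_coefficients g b /\
    (forall z, unit_disk z -> g z <> RtoC 0) /\
    (forall z, unit_disk z -> phi z = (f z / g z)%C).

Lemma quotient_divide phi z0 :
  disk_quotient phi -> unit_disk z0 ->
  exists psi, disk_quotient psi /\
    forall z, unit_disk z -> phi z = (phi z0 + (z - z0) * psi z)%C.
Proof.
  intros (f & a & g & b & Hf & Hg & Hg0 & Hphi) Hz0.
  assert (HN := taylor_lin f g a b (- phi z0)%C Hf Hg).
  destruct (taylor_divide _ _ z0 HN Hz0) as (n & c & Hn & HNn & _).
  exists (fun z => n z / g z)%C. split.
  - now exists n, c, g, b.
  - intros z Hz. specialize (HNn z Hz). cbv beta in HNn.
    rewrite !Hphi in * by auto.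
    assert (f z = f z0 / g z0 * g z + (z - z0) * n z)%C as ->.
    { transitivity ((f z + - (f z0 / g z0) * g z) + f z0 / g z0 * g z)%C; [ring|].
      rewrite HNn. field. auto. }
    field. auto.
Qed.

Lemma quotient_local_bound phi z0 :
  disk_quotient phi -> unit_disk z0 ->
  exists K d, 0 <= K /\ 0 < d /\
    forall z, Cmod (z - z0) < d -> unit_disk z /\ Cmod (phi z) <= K.
Proof.
  intros (f & a & g & b & Hf & Hg & Hg0 & Hphi) Hz0.
  destruct (taylor_local_bound f a z0 Hf Hz0) as (K & d & HK & Hd & Hb).
  destruct (taylor_divide g b z0 Hg Hz0) as (h & c & Hh & Hgh & _).
  destruct (taylor_local_bound h c z0 Hh Hz0) as (K' & d' & HK' & Hd' & Hb').
  set (m := Cmod (g z0)).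
  assert (Hm : 0 < m) by (apply Cmod_gt_0; auto).
  exists (K / (m / 2)), (Rmin (Rmin d d') (m / 2 / (K' + 1))).
  split; [apply Rdiv_le_0_compat; lra|]. split.
  { repeat apply Rmin_pos; auto. apply Rdiv_lt_0_compat; lra. }
  intros z Hz.
  assert (H1 := Rlt_le_trans _ _ _ Hz (Rmin_r _ _)).
  assert (H2 := Rlt_le_trans _ _ _ Hz (Rmin_l _ _)).
  assert (H3 := Rlt_le_trans _ _ _ H2 (Rmin_l _ _)).
  assert (H4 := Rlt_le_trans _ _ _ H2 (Rmin_r _ _)).
  destruct (Hb z H3) as [Hzd HKz]. destruct (Hb' z H4) as [_ HKz'].
  split; auto. rewrite Hphi, Cmod_div by auto.
  apply Rlt_div_r in H1; [|lra].
  assert (Hgz : m / 2 <= Cmod (g z)).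
  { assert (H5 : m <= Cmod (g z) + Cmod (z - z0) * Cmod (h z)).
    { unfold m. rewrite <- Cmod_mult, <- (Cmod_opp ((z - z0) * h z)).
      eapply Rle_trans; [|apply Cmod_triangle]. right. f_equal.
      rewrite (Hgh z Hzd). ring. }
    assert (H6 := Cmod_ge_0 (z - z0)). nra. }
  apply Rmult_le_compat; auto using Cmod_ge_0.
  - left. apply Rinv_0_lt_compat. lra.
  - apply Rinv_le_contravar; lra.
Qed.

(** Compactness of the closed disk, in Lebesgue-number form.  With [P z d] taken
    to be [u z <= / d] it bounds a function [u]; with [u z <= S - d] it shows that
    a supremum [S] which is not attained could be lowered. *)
Lemma closed_disk_uniform (P : C -> R -> Prop) r :
  (forall z d d', 0 < d' <= d -> P z d -> P z d') ->
  (forall z0, Cmod z0 <= r -> exists d, 0 < d /\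
    forall z, Cmod z <= r -> Cmod (z - z0) < d -> P z d) ->
  exists d, 0 < d /\ forall z, Cmod z <= r -> P z d.
Proof.
  intros Hmon Hloc.
  assert (Hbox : forall z0 : C, exists d : posreal, forall z, Cmod z <= r ->
    Rabs (fst z - fst z0) < d -> Rabs (snd z - snd z0) < d -> P z d).
  { intros z0.
    assert (Htri : forall z, Cmod (z - z0) <= Rabs (fst z - fst z0) + Rabs (snd z - snd z0)).
    { intros z.
      replace (z - z0)%C with (RtoC (fst z - fst z0) + Ci * RtoC (snd z - snd z0))%C
        by (apply injective_projections; simpl; ring).
      eapply Rle_trans; [apply Cmod_triangle|].
      rewrite Cmod_mult, Cmod_Ci, !Cmod_R. lra. }
    destruct (Rle_dec (Cmod z0) r) as [H0|H0].
    - destruct (Hloc z0 H0) as (d & Hd & H).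
      assert (Hd2 : 0 < d / 2) by lra.
      exists (mkposreal _ Hd2). intros z Hz H1 H2. simpl in *.
      apply Hmon with d; [lra|]. apply H; auto. specialize (Htri z). lra.
    - assert (Hd2 : 0 < (Cmod z0 - r) / 2) by lra.
      exists (mkposreal _ Hd2). intros z Hz H1 H2. simpl in *. exfalso.
      specialize (Htri z). rewrite <- Cmod_opp in Htri.
      assert (H3 := Cmod_triangle (- (z - z0)) z).
      replace (- (z - z0) + z)%C with z0 in H3 by ring. lra. }
  destruct (functional_choice _ Hbox) as [delta Hdelta].
  destruct (compactness_value_2d (- r) r (- r) r (fun x y => delta (x, y))) as [d Hd].
  exists d. split; [apply d|]. intros z Hz. apply NNPP. intros HP.
  assert (Hx : Rabs (fst z) <= r /\ Rabs (snd z) <= r).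
  { assert (H1 := Rmax_Cmod z). assert (H2 := Rmax_l (Rabs (fst z)) (Rabs (snd z))).
    assert (H3 := Rmax_r (Rabs (fst z)) (Rabs (snd z))). lra. }
  destruct Hx as [Hx Hy]. apply Rabs_le_between in Hx. apply Rabs_le_between in Hy.
  apply (Hd (fst z) (snd z) Hx Hy).
  intros (u & v & _ & _ & H1 & H2 & H3). apply HP.
  apply Hmon with (delta (u, v)); [split; [apply d|auto]|].
  apply Hdelta; auto.
Qed.

Lemma closed_disk_max (u : C -> R) r :
  0 <= r ->
  (forall z0, Cmod z0 <= r -> forall eps, 0 < eps -> exists d, 0 < d /\
    forall z, Cmod (z - z0) < d -> u z < u z0 + eps) ->
  exists z0, Cmod z0 <= r /\ forall z, Cmod z <= r -> u z <= u z0.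
Proof.
  intros Hr Hu.
  destruct (closed_disk_uniform (fun z d => u z <= / d) r) as (d & Hd & Hbd).
  { intros z d d' H H'. eapply Rle_trans; [exact H'|]. apply Rinv_le_contravar; lra. }
  { intros z0 Hz0. destruct (Hu z0 Hz0 1 Rlt_0_1) as (d & Hd & H).
    assert (H1 := Rabs_pos (u z0)). assert (H2 := Rle_abs (u z0)).
    assert (H3 : 0 < / (Rabs (u z0) + 1)) by (apply Rinv_0_lt_compat; lra).
    exists (Rmin d (/ (Rabs (u z0) + 1))). split; [now apply Rmin_pos|].
    intros z _ Hz. specialize (H z (Rlt_le_trans _ _ _ Hz (Rmin_l _ _))).
    apply Rle_trans with (/ / (Rabs (u z0) + 1)).
    - rewrite Rinv_inv. lra.
    - apply Rinv_le_contravar; [now apply Rmin_pos|apply Rmin_r]. }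
  destruct (completeness (fun y => exists z, Cmod z <= r /\ y = u z)) as [S [HS1 HS2]].
  { exists (/ d). intros y (z & Hz & ->). auto. }
  { exists (u (RtoC 0)), (RtoC 0). rewrite Cmod_0. auto. }
  assert (HS : forall z, Cmod z <= r -> u z <= S).
  { intros z Hz. apply HS1. now exists z. }
  apply NNPP. intros Hno.
  destruct (closed_disk_uniform (fun z d => u z <= S - d) r) as (e & He & Hbe).
  { intros z e e' H H'. lra. }
  { intros z0 Hz0.
    assert (Hlt : u z0 < S).
    { destruct (HS z0 Hz0) as [H|H]; auto. exfalso. apply Hno.
      exists z0. split; auto. intros z Hz. rewrite H. auto. }
    destruct (Hu z0 Hz0 ((S - u z0) / 2)) as (e & He & H); [lra|].
    exists (Rmin e ((S - u z0) / 2)). split; [apply Rmin_pos; lra|].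
    intros z _ Hz. specialize (H z (Rlt_le_trans _ _ _ Hz (Rmin_l _ _))).
    assert (H1 := Rmin_r e ((S - u z0) / 2)). lra. }
  assert (H : S <= S - e).
  { apply HS2. intros y (z & Hz & ->). auto. }
  lra.
Qed.

Lemma Cmod2 (z : C) : Cmod z ^ 2 = fst z ^ 2 + snd z ^ 2.
Proof. apply Cmod2_alt. Qed.

Lemma quotient_Cmod2_usc phi eps z0 :
  disk_quotient phi -> unit_disk z0 -> 0 <= eps -> forall e, 0 < e ->
  exists d, 0 < d /\ forall z, Cmod (z - z0) < d ->
    Cmod (phi z) ^ 2 + eps * Cmod z ^ 2 < Cmod (phi z0) ^ 2 + eps * Cmod z0 ^ 2 + e.
Proof.
  intros Hphi Hz0 Heps e He.
  destruct (quotient_divide phi z0 Hphi Hz0) as (psi & Hpsi & Heq).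
  destruct (quotient_local_bound psi z0 Hpsi Hz0) as (K & d & HK & Hd & Hb).
  set (m := Cmod (phi z0)). set (q := Cmod z0).
  assert (Hm : 0 <= m) by apply Cmod_ge_0.
  assert (Hq : 0 <= q) by apply Cmod_ge_0.
  set (L := 2 * K * m + K ^ 2 + eps * (2 * q + 1)).
  assert (HL : 0 <= L) by (unfold L; nra).
  exists (Rmin (Rmin d 1) (e / (L + 1))). split.
  { repeat apply Rmin_pos; try lra. apply Rdiv_lt_0_compat; lra. }
  intros z Hz.
  assert (H1 := Rlt_le_trans _ _ _ Hz (Rmin_r _ _)).
  assert (H2 := Rlt_le_trans _ _ _ Hz (Rmin_l _ _)).
  assert (H3 := Rlt_le_trans _ _ _ H2 (Rmin_l _ _)).
  assert (H4 := Rlt_le_trans _ _ _ H2 (Rmin_r _ _)).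
  apply Rlt_div_r in H1; [|lra].
  destruct (Hb z H3) as [Hzd HKz].
  set (h := Cmod (z - z0)) in *.
  assert (Hh : 0 <= h) by apply Cmod_ge_0.
  assert (Hp : 0 <= Cmod (phi z) <= m + h * K).
  { split; [apply Cmod_ge_0|]. rewrite (Heq z Hzd).
    eapply Rle_trans; [apply Cmod_triangle|]. rewrite Cmod_mult. fold m h. nra. }
  assert (Hz' : 0 <= Cmod z <= q + h).
  { split; [apply Cmod_ge_0|]. replace z with (z0 + (z - z0))%C by ring.
    eapply Rle_trans; [apply Cmod_triangle|]. fold q h. lra. }
  apply Rle_lt_trans with ((m + h * K) ^ 2 + eps * (q + h) ^ 2).
  { apply Rplus_le_compat; [|apply Rmult_le_compat_l; auto]; apply pow_incr; auto. }
  assert (Hhh : h * h <= h) by nra.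
  assert (H5 : K ^ 2 * (h * h) <= K ^ 2 * h) by (apply Rmult_le_compat_l; nra).
  assert (H6 : eps * (h * h) <= eps * h) by (apply Rmult_le_compat_l; nra).
  unfold L in H1. nra.
Qed.

(** At an interior maximum of [|phi|^2 + eps |z|^2] average over [z0 + h] with
    [h = t, -t, it, -it]: the terms of degrees one and two in [h] of the
    expansion of [phi] cancel, so [phi] averages to [phi z0] up to [O(t^3)],
    whereas [eps |z|^2] gains [eps t^2]. *)
Lemma quotient_no_interior_max phi eps r z0 :
  disk_quotient phi -> r < 1 -> 0 < eps -> Cmod z0 < r ->
  (forall z, Cmod z <= r -> Cmod (phi z) ^ 2 + eps * Cmod z ^ 2 <=
     Cmod (phi z0) ^ 2 + eps * Cmod z0 ^ 2) -> False.
Proof.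
  intros Hphi Hr Heps Hz0 Hmax.
  assert (Hd0 : unit_disk z0) by (unfold unit_disk; lra).
  destruct (quotient_divide phi z0 Hphi Hd0) as (p1 & Hp1 & E1).
  destruct (quotient_divide p1 z0 Hp1 Hd0) as (p2 & Hp2 & E2).
  destruct (quotient_divide p2 z0 Hp2 Hd0) as (p3 & Hp3 & E3).
  destruct (quotient_local_bound p3 z0 Hp3 Hd0) as (K & d & HK & Hd & Hb).
  set (m := Cmod (phi z0)). assert (Hm : 0 <= m) by apply Cmod_ge_0.
  assert (HmK : 0 <= m * K) by nra.
  set (t := Rmin (Rmin (d / 2) ((r - Cmod z0) / 2)) (eps / (4 * (m * K) + 1))).
  assert (Ht0 : 0 < t).
  { repeat apply Rmin_pos; try lra. apply Rdiv_lt_0_compat; lra. }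
  assert (Ht1 : t <= d / 2) by (eapply Rle_trans; [apply Rmin_l|apply Rmin_l]).
  assert (Ht2 : t <= (r - Cmod z0) / 2)
    by (eapply Rle_trans; [apply Rmin_l|apply Rmin_r]).
  assert (Ht3 : t * (4 * (m * K) + 1) <= eps).
  { apply Rle_div_r; [lra|apply Rmin_r]. }
  assert (Hh : forall h : C, Cmod h = t -> exists e : C,
    phi (z0 + h)%C = (phi z0 + h * p1 z0 + h * h * p2 z0 + e)%C /\
    Rabs (fst e) <= t ^ 3 * K /\ Rabs (snd e) <= t ^ 3 * K /\
    Cmod (phi (z0 + h)%C) ^ 2 + eps * Cmod (z0 + h) ^ 2 <=
      m ^ 2 + eps * Cmod z0 ^ 2).
  { intros h Hht.
    assert (Hin : Cmod (z0 + h) <= r).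
    { eapply Rle_trans; [apply Cmod_triangle|]. lra. }
    assert (Hnb : Cmod (z0 + h - z0) < d).
    { replace (z0 + h - z0)%C with h by ring. lra. }
    destruct (Hb _ Hnb) as [Hzd HKz].
    exists (h * h * h * p3 (z0 + h))%C.
    assert (He : Cmod (h * h * h * p3 (z0 + h)%C) <= t ^ 3 * K).
    { rewrite !Cmod_mult, Hht. replace (t ^ 3) with (t * t * t) by ring.
      apply Rmult_le_compat_l; auto. nra. }
    assert (H1 := Rmax_Cmod (h * h * h * p3 (z0 + h)%C)%C).
    split; [|split; [|split]].
    - rewrite (E1 _ Hzd), (E2 _ Hzd), (E3 _ Hzd). ring.
    - eapply Rle_trans; [|exact He]. eapply Rle_trans; [apply Rmax_l|exact H1].
    - eapply Rle_trans; [|exact He]. eapply Rle_trans; [apply Rmax_r|exact H1].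
    - apply Hmax; auto. }
  assert (Ht : Rabs t = t) by (apply Rabs_pos_eq; lra).
  destruct (Hh (RtoC t)) as (e1 & F1 & B1 & B1' & M1); [now rewrite Cmod_R|].
  destruct (Hh (- RtoC t)%C) as (e2 & F2 & B2 & B2' & M2);
    [now rewrite Cmod_opp, Cmod_R|].
  destruct (Hh (Ci * RtoC t)%C) as (e3 & F3 & B3 & B3' & M3);
    [now rewrite Cmod_mult, Cmod_Ci, Cmod_R, Rmult_1_l|].
  destruct (Hh (- (Ci * RtoC t))%C) as (e4 & F4 & B4 & B4' & M4);
    [now rewrite Cmod_opp, Cmod_mult, Cmod_Ci, Cmod_R, Rmult_1_l|].
  assert (Hsum : (phi (z0 + RtoC t) + phi (z0 + - RtoC t) + phi (z0 + Ci * RtoC t)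
     + phi (z0 + - (Ci * RtoC t)) = phi z0 + phi z0 + phi z0 + phi z0 + (e1 + e2 + e3 + e4))%C).
  { rewrite F1, F2, F3, F4.
    assert (HCi : (Ci * Ci)%C = (- RtoC 1)%C)
      by (apply injective_projections; simpl; ring).
    transitivity (phi z0 + phi z0 + phi z0 + phi z0 + (e1 + e2 + e3 + e4)
      + (RtoC 1 + Ci * Ci) * (RtoC t * RtoC t * p2 z0 + RtoC t * RtoC t * p2 z0))%C.
    - ring.
    - rewrite HCi. ring. }
  clear F1 F2 F3 F4 Hh.
  set (w1 := phi (z0 + RtoC t)%C) in *. set (w2 := phi (z0 + - RtoC t)%C) in *.
  set (w3 := phi (z0 + Ci * RtoC t)%C) in *.
  set (w4 := phi (z0 + - (Ci * RtoC t))%C) in *.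
  assert (Hz4 : Cmod (z0 + RtoC t) ^ 2 + Cmod (z0 + - RtoC t) ^ 2 +
    Cmod (z0 + Ci * RtoC t) ^ 2 + Cmod (z0 + - (Ci * RtoC t)) ^ 2 =
    4 * Cmod z0 ^ 2 + 4 * t ^ 2).
  { rewrite !Cmod2. destruct z0 as [x y]. simpl. ring. }
  assert (Hfst := f_equal fst Hsum). assert (Hsnd := f_equal snd Hsum).
  assert (Hm2 : m ^ 2 = fst (phi z0) ^ 2 + snd (phi z0) ^ 2) by apply Cmod2.
  assert (Hmx := Rmax_Cmod (phi z0)). fold m in Hmx.
  assert (Ha : Rabs (fst (phi z0)) <= m) by (eapply Rle_trans; [apply Rmax_l|exact Hmx]).
  assert (Hb' : Rabs (snd (phi z0)) <= m) by (eapply Rle_trans; [apply Rmax_r|exact Hmx]).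
  rewrite (Cmod2 w1) in M1. rewrite (Cmod2 w2) in M2.
  rewrite (Cmod2 w3) in M3. rewrite (Cmod2 w4) in M4.
  set (a := fst (phi z0)) in *. set (b := snd (phi z0)) in *.
  assert (Hprod : forall c x, Rabs c <= m -> Rabs x <= t ^ 3 * K ->
    - (m * (t ^ 3 * K)) <= c * x).
  { intros c x Hc Hx. assert (H := Rle_abs (- (c * x))).
    rewrite Rabs_Ropp, Rabs_mult in H.
    assert (Rabs c * Rabs x <= m * (t ^ 3 * K))
      by (apply Rmult_le_compat; auto using Rabs_pos).
    lra. }
  assert (X1 := Hprod _ _ Ha B1). assert (X2 := Hprod _ _ Ha B2).
  assert (X3 := Hprod _ _ Ha B3). assert (X4 := Hprod _ _ Ha B4).
  assert (Y1 := Hprod _ _ Hb' B1'). assert (Y2 := Hprod _ _ Hb' B2').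
  assert (Y3 := Hprod _ _ Hb' B3'). assert (Y4 := Hprod _ _ Hb' B4').
  simpl in Hfst, Hsnd. fold a in Hfst. fold b in Hsnd.
  assert (Hsq : forall w : C, fst w ^ 2 + snd w ^ 2 >=
    2 * (a * fst w) + 2 * (b * snd w) - m ^ 2).
  { intros w. rewrite Hm2. assert (H1 := pow2_ge_0 (fst w - a)).
    assert (H2 := pow2_ge_0 (snd w - b)). nra. }
  assert (S1 := Hsq w1). assert (S2 := Hsq w2).
  assert (S3 := Hsq w3). assert (S4 := Hsq w4).
  assert (Hx : a * fst w1 + a * fst w2 + a * fst w3 + a * fst w4 = 4 * (a * a) +
     (a * fst e1 + a * fst e2 + a * fst e3 + a * fst e4)).
  { transitivity (a * (fst w1 + fst w2 + fst w3 + fst w4)); [ring|].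
    rewrite Hfst. ring. }
  assert (Hy : b * snd w1 + b * snd w2 + b * snd w3 + b * snd w4 = 4 * (b * b) +
     (b * snd e1 + b * snd e2 + b * snd e3 + b * snd e4)).
  { transitivity (b * (snd w1 + snd w2 + snd w3 + snd w4)); [ring|].
    rewrite Hsnd. ring. }
  assert (Hz4' := f_equal (Rmult eps) Hz4).
  assert (Hfin : 4 * (eps * t ^ 2) <= 16 * (m * (t ^ 3 * K))) by lra.
  assert (Ht' : 0 < t ^ 2) by (apply pow_lt; lra).
  assert (eps <= 4 * (m * K) * t).
  { apply Rmult_le_reg_r with (t ^ 2); auto. nra. }
  nra.
Qed.

(** The square of the modulus is perturbed to [|phi|^2 + eps |z|^2], with [eps] so
    small that a value of [|phi|] above [M] still forces the maximum inside. *)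
Lemma quotient_maximum_principle phi r M :
  disk_quotient phi -> 0 < r < 1 ->
  (forall z, Cmod z = r -> Cmod (phi z) <= M) ->
  forall z, Cmod z <= r -> Cmod (phi z) <= M.
Proof.
  intros Hphi Hr HM z Hz. apply Rnot_lt_le. intros Hlt.
  assert (HM0 : 0 <= M).
  { eapply Rle_trans; [apply (Cmod_ge_0 (phi (RtoC r)))|apply HM].
    rewrite Cmod_R, Rabs_pos_eq; lra. }
  set (eps := (Cmod (phi z) ^ 2 - M ^ 2) / 2).
  assert (Heps : 0 < eps) by (unfold eps; nra).
  destruct (closed_disk_max (fun z => Cmod (phi z) ^ 2 + eps * Cmod z ^ 2) r)
    as (z0 & Hz0 & Hmax); [lra| |].
  { intros z0 Hz0 e He. apply quotient_Cmod2_usc; auto; unfold unit_disk; lra. }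
  destruct Hz0 as [Hz0|Hz0].
  - apply (quotient_no_interior_max phi eps r z0); auto; lra.
  - specialize (Hmax z Hz). cbv beta in Hmax. rewrite Hz0 in Hmax.
    assert (H1 : Cmod (phi z0) ^ 2 <= M ^ 2).
    { apply pow_incr. split; [apply Cmod_ge_0|auto]. }
    assert (H2 := pow2_ge_0 (Cmod z)).
    assert (H3 : eps * r ^ 2 <= eps * 1) by (apply Rmult_le_compat_l; nra).
    assert (0 <= eps * Cmod z ^ 2) by nra.
    unfold eps in *. lra.
Qed.

(** * Schwarz lemma and the Schur algorithm *)

Lemma taylor_shift f a :
  taylor_coefficients f a -> a 0%nat = RtoC 0 ->
  exists g, taylor_coefficients g (fun n => a (S n)) /\
    forall z, unit_disk z -> f z = (z * g z)%C.
Proof.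
  intros Hf Ha0.
  destruct (subexponential_taylor (fun n => a (S n))) as [g Hg].
  { apply (subexponential_shift a 1). now apply taylor_subexponential with f. }
  exists g. split; auto. intros z Hz.
  assert (H := is_pseries_cons a z (g z) (Hg z Hz)).
  rewrite Ha0, Cplus_0_l in H. apply is_pseries_C_unique with a z; auto.
Qed.

(** The maximum principle on [|z| <= r] bounds [g / h] by [s / r]; let [r]
    tend to one. *)
Lemma schwarz f a h b s :
  taylor_coefficients f a -> taylor_coefficients h b -> a 0%nat = RtoC 0 ->
  (forall z, unit_disk z -> h z <> RtoC 0) ->
  (forall z, unit_disk z -> Cmod (f z) <= s * Cmod (h z)) ->
  exists g, taylor_coefficients g (fun n => a (S n)) /\
    forall z, unit_disk z -> Cmod (g z) <= s * Cmod (h z).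
Proof.
  intros Hf Hh Ha0 Hh0 Hle.
  destruct (taylor_shift f a Hf Ha0) as (g & Hg & Hfg).
  exists g. split; auto.
  assert (Hs : 0 <= s).
  { assert (H := Hle _ unit_disk_0). assert (H1 := Cmod_ge_0 (f (RtoC 0))).
    assert (0 < Cmod (h (RtoC 0))) by (apply Cmod_gt_0, Hh0, unit_disk_0). nra. }
  assert (Hq : disk_quotient (fun z => g z / h z)%C).
  { now exists g, (fun n => a (S n)), h, b. }
  intros z Hz. assert (Hhz : 0 < Cmod (h z)) by (apply Cmod_gt_0, Hh0, Hz).
  assert (Hz0 := Cmod_ge_0 z). assert (Hz1 := Hz). unfold unit_disk in Hz1.
  assert (Hr : forall r, Cmod z < r < 1 -> r * Cmod (g z) <= s * Cmod (h z)).
  { intros r Hr.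
    assert (Hm := quotient_maximum_principle _ r (s / r) Hq).
    assert (H : Cmod (g z / h z) <= s / r).
    { apply Hm; try lra. intros w Hw.
      assert (Hwd : unit_disk w) by (unfold unit_disk; lra).
      assert (Hhw : 0 < Cmod (h w)) by (apply Cmod_gt_0, Hh0, Hwd).
      rewrite Cmod_div by auto. apply (Rle_div_r _ s r); [lra|].
      replace (Cmod (g w) / Cmod (h w) * r) with (Cmod (f w) / Cmod (h w)).
      - apply Rle_div_l; auto.
      - rewrite (Hfg w Hwd), Cmod_mult, Hw. field. lra. }
    rewrite Cmod_div in H by auto.
    assert (H' : Cmod (g z) / Cmod (h z) * r <= s) by (apply Rle_div_r; [lra|exact H]).
    replace (r * Cmod (g z)) with (Cmod (g z) / Cmod (h z) * r * Cmod (h z))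
      by (field; lra).
    apply Rmult_le_compat_r; lra. }
  apply Rnot_lt_le. intros Hlt.
  set (G := Cmod (g z)) in *. set (H := Cmod (h z)) in *.
  assert (Hsh : 0 <= s * H) by nra.
  set (q := s * H / G).
  assert (Hq1 : 0 <= q < 1 /\ q * G = s * H).
  { unfold q. split; [split|].
    - apply Rdiv_le_0_compat; lra.
    - apply Rlt_div_l; lra.
    - field. lra. }
  assert (H1 := Rmax_l (Cmod z) q). assert (H2 := Rmax_r (Cmod z) q).
  assert (H3 : Rmax (Cmod z) q < 1) by (apply Rmax_lub_lt; lra).
  specialize (Hr ((1 + Rmax (Cmod z) q) / 2) ltac:(lra)). nra.
Qed.

(** Moebius maps of the disk preserve the disk, with denominators cleared. *)
Lemma schur_identity (u v s : C) :
  Cmod (v - Cconj s * u) ^ 2 - Cmod (u - s * v) ^ 2 =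
  (Cmod v ^ 2 - Cmod u ^ 2) * (1 - Cmod s ^ 2).
Proof.
  rewrite !Cmod2. destruct u, v, s. simpl. ring.
Qed.

(** One step of Schur's algorithm for [w = f / g], run on the pair [(f, g)] so
    that only power series occur: [(w - s) / (1 - conj s w)] with [s = w 0] is
    the quotient of [f - s g] by [g - conj s f], and [f1] is [f - s g] divided by
    [z].  The bound [sigma < 1] keeps
    [|s| < 1], so that the new denominator does not vanish. *)
Lemma schur_step f a g b sigma :
  taylor_coefficients f a -> taylor_coefficients g b -> sigma < 1 ->
  (forall z, unit_disk z -> g z <> RtoC 0) ->
  (forall z, unit_disk z -> Cmod (f z) <= sigma * Cmod (g z)) ->
  let s := (a 0%nat / b 0%nat)%C in
  Cmod s < 1 /\
  exists f1 g1 sigma1,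
    taylor_coefficients f1 (fun n => a (S n) + - s * b (S n))%C /\
    taylor_coefficients g1 (fun n => b n + - Cconj s * a n)%C /\
    sigma1 < 1 /\
    (forall z, unit_disk z -> g1 z <> RtoC 0) /\
    (forall z, unit_disk z -> Cmod (f1 z) <= sigma1 * Cmod (g1 z)).
Proof.
  intros Hf Hg Hsig Hg0 Hle s.
  assert (Hpos : forall z, unit_disk z -> 0 < Cmod (g z)).
  { intros z Hz. now apply Cmod_gt_0, Hg0. }
  assert (Hb0 : b 0%nat <> RtoC 0).
  { rewrite <- (taylor_at_0 g b Hg). apply Hg0, unit_disk_0. }
  assert (Hs : Cmod s <= sigma).
  { unfold s. rewrite <- (taylor_at_0 g b Hg), <- (taylor_at_0 f a Hf).
    rewrite Cmod_div by apply Hg0, unit_disk_0.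
    apply Rle_div_l; [apply Hpos, unit_disk_0|apply Hle, unit_disk_0]. }
  assert (Hs0 := Cmod_ge_0 s).
  split; [lra|].
  set (g1 := fun z => (g z + - Cconj s * f z)%C).
  set (f0 := fun z => (f z + - s * g z)%C).
  assert (Hg1 : taylor_coefficients g1 (fun n => b n + - Cconj s * a n)%C)
    by now apply taylor_lin.
  assert (Hf0 : taylor_coefficients f0 (fun n => a n + - s * b n)%C)
    by now apply taylor_lin.
  assert (Hlow : forall z, unit_disk z ->
    (1 - sigma ^ 2) * Cmod (g z) <= Cmod (g1 z) <= 2 * Cmod (g z)).
  { intros z Hz. specialize (Hle z Hz). specialize (Hpos z Hz).
    assert (Hc : Cmod (Cconj s * f z) <= sigma ^ 2 * Cmod (g z)).
    { rewrite Cmod_mult, Cmod_conj. replace (sigma ^ 2) with (sigma * sigma) by ring.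
      rewrite Rmult_assoc. apply Rmult_le_compat; auto using Cmod_ge_0. }
    assert (sigma ^ 2 <= 1) by nra.
    split.
    - assert (H1 : Cmod (g z) <= Cmod (g1 z) + Cmod (Cconj s * f z)).
      { replace (g z) with (g1 z + Cconj s * f z)%C at 1 by (unfold g1; ring).
        apply Cmod_triangle. }
      lra.
    - unfold g1. eapply Rle_trans; [apply Cmod_triangle|].
      replace (- Cconj s * f z)%C with (- (Cconj s * f z))%C by ring.
      rewrite Cmod_opp. nra. }
  assert (Hsig2 : 0 < 1 - sigma ^ 2 <= 1) by nra.
  assert (Hg10 : forall z, unit_disk z -> g1 z <> RtoC 0).
  { intros z Hz. apply Cmod_gt_0. specialize (Hlow z Hz). specialize (Hpos z Hz). nra. }
  (* from [|g1|^2 - |f0|^2 = (|g|^2 - |f|^2)(1 - |s|^2) >= k |g1|^2] *)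
  set (k := ((1 - sigma ^ 2) / 2) ^ 2).
  assert (Hk : 0 < k < 1) by (unfold k; nra).
  destruct (schwarz f0 _ g1 _ (sqrt (1 - k)) Hf0 Hg1) as (f1 & Hf1 & Hle1); auto.
  { unfold s. field. auto. }
  { intros z Hz. specialize (Hlow z Hz). specialize (Hpos z Hz). specialize (Hle z Hz).
    assert (Hf1 := Cmod_ge_0 (f z)). assert (Hid := schur_identity (f z) (g z) s).
    replace (f z - s * g z)%C with (f0 z) in Hid by (unfold f0; ring).
    replace (g z - Cconj s * f z)%C with (g1 z) in Hid by (unfold g1; ring).
    apply Rsqr_incr_0_var; [|apply Rmult_le_pos; [apply sqrt_pos|apply Cmod_ge_0]].
    rewrite Rsqr_mult, Rsqr_sqrt by lra.
    rewrite !Rsqr_pow2.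
    assert (E1 : (1 - sigma ^ 2) * Cmod (g z) ^ 2 <= Cmod (g z) ^ 2 - Cmod (f z) ^ 2).
    { assert (Cmod (f z) ^ 2 <= (sigma * Cmod (g z)) ^ 2) by (apply pow_incr; auto).
      nra. }
    assert (E2 : 1 - sigma ^ 2 <= 1 - Cmod s ^ 2) by nra.
    assert (E3 : Cmod (g1 z) ^ 2 <= (2 * Cmod (g z)) ^ 2).
    { apply pow_incr. split; [apply Cmod_ge_0|apply Hlow]. }
    assert (E4 : ((1 - sigma ^ 2) * Cmod (g z) ^ 2) * (1 - sigma ^ 2) <=
       (Cmod (g z) ^ 2 - Cmod (f z) ^ 2) * (1 - Cmod s ^ 2)).
    { apply Rmult_le_compat; auto; [|lra]. assert (0 <= Cmod (g z) ^ 2) by nra. nra. }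
    assert (E5 : k * Cmod (g1 z) ^ 2 <= k * (2 * Cmod (g z)) ^ 2)
      by (apply Rmult_le_compat_l; lra).
    replace (k * (2 * Cmod (g z)) ^ 2)
      with ((1 - sigma ^ 2) * Cmod (g z) ^ 2 * (1 - sigma ^ 2)) in E5
      by (unfold k; field).
    lra. }
  exists f1, g1, (sqrt (1 - k)). repeat split; auto.
  rewrite <- sqrt_1 at 2. apply sqrt_lt_1; lra.
Qed.

Lemma mult_Cconj (z : C) : (z * Cconj z)%C = RtoC (Cmod z ^ 2).
Proof.
  rewrite Cmod2. apply injective_projections; destruct z; simpl; ring.
Qed.

(** Three steps of Schur's algorithm describe the first three coefficients
    [w1, w2, w3] of [f / g]; that quotient is only present through the equations
    [f = (w1 + w2 z + w3 z^2 + ...) g] between coefficients. *)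
Lemma schur_parameters f a g b sigma (w1 w2 w3 : C) :
  taylor_coefficients f a -> taylor_coefficients g b -> sigma < 1 ->
  (forall z, unit_disk z -> g z <> RtoC 0) ->
  (forall z, unit_disk z -> Cmod (f z) <= sigma * Cmod (g z)) ->
  a 0%nat = (w1 * b 0%nat)%C ->
  a 1%nat = (w1 * b 1%nat + w2 * b 0%nat)%C ->
  a 2%nat = (w1 * b 2%nat + w2 * b 1%nat + w3 * b 0%nat)%C ->
  Cmod w1 <= 1 /\ exists x zeta,
    Cmod x <= 1 /\ Cmod zeta <= 1 /\
    w2 = (RtoC (1 - Cmod w1 ^ 2) * x)%C /\
    w3 = (RtoC (1 - Cmod w1 ^ 2) *
          (RtoC (1 - Cmod x ^ 2) * zeta - Cconj w1 * x * x))%C.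
Proof.
  intros Hf Hg Hsig Hg0 Hle E0 E1 E2.
  assert (Hb0 : b 0%nat <> RtoC 0).
  { rewrite <- (taylor_at_0 g b Hg). apply Hg0, unit_disk_0. }
  destruct (schur_step f a g b sigma Hf Hg Hsig Hg0 Hle)
    as (Hs1 & f1 & g1 & sigma1 & Hf1 & Hg1 & Hsig1 & Hg10 & Hle1).
  replace (a 0%nat / b 0%nat)%C with w1 in * by (rewrite E0; field; auto).
  set (x := (w2 / RtoC (1 - Cmod w1 ^ 2))%C).
  assert (Hd1 : 0 < 1 - Cmod w1 ^ 2) by (assert (H := Cmod_ge_0 w1); nra).
  assert (Hd1' : RtoC (1 - Cmod w1 ^ 2) <> RtoC 0).
  { intros H. apply RtoC_inj in H. lra. }
  assert (Hw2 : w2 = (RtoC (1 - Cmod w1 ^ 2) * x)%C) by (unfold x; field; auto).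
  assert (Hw1 : (w1 * Cconj w1)%C = (RtoC 1 - RtoC (1 - Cmod w1 ^ 2))%C).
  { rewrite mult_Cconj, RtoC_minus. ring. }
  assert (G0 : (b 0%nat + - Cconj w1 * a 0%nat)%C = (RtoC (1 - Cmod w1 ^ 2) * b 0%nat)%C).
  { rewrite E0. transitivity ((RtoC 1 - w1 * Cconj w1) * b 0%nat)%C; [ring|].
    rewrite Hw1. ring. }
  destruct (schur_step f1 _ g1 _ sigma1 Hf1 Hg1 Hsig1 Hg10 Hle1)
    as (Hs2 & f2 & g2 & sigma2 & Hf2 & Hg2 & Hsig2 & Hg20 & Hle2).
  cbv beta in *. rewrite G0 in *.
  replace ((a 1%nat + - w1 * b 1%nat) / (RtoC (1 - Cmod w1 ^ 2) * b 0%nat))%C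
    with x in * by (rewrite E1, Hw2; field; auto).
  assert (Hd2 : 0 < 1 - Cmod x ^ 2) by (assert (H := Cmod_ge_0 x); nra).
  assert (Hd2' : RtoC (1 - Cmod x ^ 2) <> RtoC 0).
  { intros H. apply RtoC_inj in H. lra. }
  assert (Hx : (x * Cconj x)%C = (RtoC 1 - RtoC (1 - Cmod x ^ 2))%C).
  { rewrite mult_Cconj, RtoC_minus. ring. }
  destruct (schur_step f2 _ g2 _ sigma2 Hf2 Hg2 Hsig2 Hg20 Hle2) as (Hs3 & _).
  cbv beta in Hs3.
  split; [lra|]. eexists x, _. split; [lra|]. split; [apply Rlt_le, Hs3|].
  split; [exact Hw2|].
  set (d1 := RtoC (1 - Cmod w1 ^ 2)) in *. set (d2 := RtoC (1 - Cmod x ^ 2)) in *.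
  rewrite G0, E2, E1.
  replace (d1 * b 0%nat + - Cconj x * (w1 * b 1%nat + w2 * b 0%nat + - w1 * b 1%nat))%C
    with (d1 * d2 * b 0%nat)%C.
  2:{ rewrite Hw2. transitivity (d1 * b 0%nat * (RtoC 1 - x * Cconj x))%C; [|ring].
      rewrite Hx. ring. }
  transitivity (((w1 * b 2%nat + w2 * b 1%nat + w3 * b 0%nat + - w1 * b 2%nat)
     + - x * (b 1%nat * (RtoC 1 - w1 * Cconj w1) - Cconj w1 * w2 * b 0%nat)) / b 0%nat
     - d1 * (Cconj w1 * x * x))%C.
  - rewrite Hw1, Hw2. field. auto.
  - field. auto.
Qed.

(** With [t = |w1|] and [rho = |x|] the triangle inequality bounds the left-hand
    side by
    [(1 - t^2) (4 t (1 - rho^2) + (3 + t^2) rho^2 + 2 t^2 rho) + 3 t^4], which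
    increases with [rho] because [3 + t^2 - 4 t = (1 - t) (3 - t)], and equals
    [3] at [rho = 1]. *)
Lemma schur_functional_bound (w1 x zeta w2 w3 : C) (k : R) :
  Rabs k <= 3 -> Cmod w1 <= 1 -> Cmod x <= 1 -> Cmod zeta <= 1 ->
  w2 = (RtoC (1 - Cmod w1 ^ 2) * x)%C ->
  w3 = (RtoC (1 - Cmod w1 ^ 2) *
        (RtoC (1 - Cmod x ^ 2) * zeta - Cconj w1 * x * x))%C ->
  Cmod (RtoC 4 * w1 * w3 - RtoC 3 * w2 * w2 + RtoC 2 * w1 * w1 * w2
        + RtoC k * w1 * w1 * w1 * w1) <= 3.
Proof.
  intros Hk Ht Hr Hz -> ->.
  assert (Hw1 := mult_Cconj w1).
  assert (Ht0 := Cmod_ge_0 w1). assert (Hr0 := Cmod_ge_0 x).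
  set (t := Cmod w1) in *. set (rho := Cmod x) in *.
  assert (Hd : 0 <= 1 - t ^ 2) by nra. assert (Hd' : 0 <= 1 - rho ^ 2) by nra.
  set (d := 1 - t ^ 2) in *.
  set (u1 := (RtoC (4 * (1 - rho ^ 2)) * (w1 * zeta))%C).
  set (u2 := (- (RtoC (3 + t ^ 2) * (x * x)))%C).
  set (u3 := (RtoC 2 * (w1 * w1 * x))%C).
  set (u4 := (RtoC k * (w1 * w1 * w1 * w1))%C).
  match goal with |- Cmod ?X <= _ => replace X with (RtoC d * (u1 + u2 + u3) + u4)%C end.
  2:{ transitivity (RtoC d * (RtoC 4 * RtoC (1 - rho ^ 2) * (w1 * zeta)
        - RtoC 4 * (w1 * Cconj w1) * (x * x) - RtoC 3 * RtoC d * (x * x)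
        + RtoC 2 * (w1 * w1 * x)) + u4)%C.
      - rewrite Hw1. unfold u1, u2, u3, d. rewrite RtoC_mult, RtoC_plus, !RtoC_minus. ring.
      - unfold u4. ring. }
  assert (H1 : Cmod u1 <= 4 * (1 - rho ^ 2) * t).
  { unfold u1. rewrite !Cmod_mult, Cmod_R, Rabs_pos_eq by lra. fold t.
    assert (0 <= Cmod zeta) by apply Cmod_ge_0.
    apply Rmult_le_compat_l; nra. }
  assert (H2 : Cmod u2 <= (3 + t ^ 2) * rho ^ 2).
  { unfold u2. rewrite Cmod_opp, !Cmod_mult, Cmod_R, Rabs_pos_eq by nra. fold rho.
    right. ring. }
  assert (H3 : Cmod u3 <= 2 * t ^ 2 * rho).
  { unfold u3. rewrite !Cmod_mult, Cmod_R, Rabs_pos_eq by lra. fold rho t.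
    right. ring. }
  assert (H4 : Cmod u4 <= 3 * t ^ 4).
  { unfold u4. rewrite !Cmod_mult, Cmod_R. fold t.
    replace (t * t * t * t) with (t ^ 4) by ring.
    apply Rmult_le_compat_r; auto. apply pow_le; auto. }
  eapply Rle_trans; [apply Cmod_triangle|].
  rewrite Cmod_mult, Cmod_R, Rabs_pos_eq by auto.
  assert (H5 : Cmod (u1 + u2 + u3) <= 3 + 3 * t ^ 2).
  { eapply Rle_trans; [apply Cmod_triangle|].
    assert (H6 := Cmod_triangle u1 u2).
    assert (H7 : (1 - t) * (3 - t) * rho ^ 2 <= (1 - t) * (3 - t) * 1)
      by (apply Rmult_le_compat_l; nra).
    assert (H8 : 2 * t ^ 2 * rho <= 2 * t ^ 2 * 1) by (apply Rmult_le_compat_l; nra).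
    lra. }
  assert (H6 : d * Cmod (u1 + u2 + u3) <= d * (3 + 3 * t ^ 2))
    by (apply Rmult_le_compat_l; auto).
  unfold d in *. lra.
Qed.

(** Replacing [w] by [t w] multiplies the monomials in [w1, w2, w3] of degree two,
    three and four by [t^2], [t^3] and [t^4]. *)
Lemma Cmod_limit_bound (u v y : C) M :
  (forall t, 0 < t < 1 -> Cmod (RtoC (t ^ 2) * u + RtoC (t ^ 3) * v + RtoC (t ^ 4) * y) <= M) ->
  Cmod (u + v + y) <= M.
Proof.
  intros H. apply Rnot_lt_le. intros Hlt.
  set (L := Cmod u + Cmod v + Cmod y).
  assert (Hu := Cmod_ge_0 u). assert (Hv := Cmod_ge_0 v). assert (Hy := Cmod_ge_0 y).
  set (gap := Cmod (u + v + y) - M).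
  assert (Hgap : 0 < gap) by (unfold gap; lra).
  assert (HL : 0 <= L) by (unfold L; lra).
  set (h := Rmin (1 / 2) (gap / (4 * L + 1))).
  assert (Hh0 : 0 < h).
  { apply Rmin_pos; [lra|]. apply Rdiv_lt_0_compat; lra. }
  assert (Hh1 : h <= 1 / 2) by apply Rmin_l.
  assert (Hh2 : h * (4 * L + 1) <= gap) by (apply Rle_div_r; [lra|apply Rmin_r]).
  set (t := 1 - h). assert (Ht : 0 < t < 1) by (unfold t; lra).
  specialize (H t Ht).
  assert (P : forall n, 0 <= 1 - t ^ n <= INR n * h).
  { induction n as [|n IH]; [simpl; lra|]. rewrite S_INR. simpl.
    replace (1 - t * t ^ n) with (h + t * (1 - t ^ n)) by (unfold t; ring).
    nra. }
  assert (T : forall n (w : C), (n <= 4)%nat -> Cmod (RtoC (1 - t ^ n) * w) <= 4 * h * Cmod w).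
  { intros n w Hn. rewrite Cmod_mult, Cmod_R, Rabs_pos_eq by apply P.
    apply Rmult_le_compat_r; [apply Cmod_ge_0|].
    eapply Rle_trans; [apply P|]. apply Rmult_le_compat_r; [lra|].
    replace 4 with (INR 4) by (simpl; lra). now apply le_INR. }
  assert (T2 := T 2%nat u ltac:(lia)). assert (T3 := T 3%nat v ltac:(lia)).
  assert (T4 := T 4%nat y ltac:(lia)).
  set (X := (RtoC (t ^ 2) * u + RtoC (t ^ 3) * v + RtoC (t ^ 4) * y)%C) in *.
  assert (E : (u + v + y)%C = (X + (RtoC (1 - t ^ 2) * u + RtoC (1 - t ^ 3) * v
     + RtoC (1 - t ^ 4) * y))%C).
  { unfold X. rewrite !RtoC_minus. ring. }
  assert (B := Cmod_triangle X (RtoC (1 - t ^ 2) * u + RtoC (1 - t ^ 3) * v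
     + RtoC (1 - t ^ 4) * y)).
  rewrite <- E in B.
  assert (B2 := Cmod_triangle (RtoC (1 - t ^ 2) * u + RtoC (1 - t ^ 3) * v)
     (RtoC (1 - t ^ 4) * y)).
  assert (B3 := Cmod_triangle (RtoC (1 - t ^ 2) * u) (RtoC (1 - t ^ 3) * v)).
  unfold gap, L in *. lra.
Qed.

(** * The bound for starlike functions *)

(** With [f = z F], the function [w] is the quotient of [f' - F] by
    [f' + (1 - 2 alpha) F], whose coefficients are [n a_(n+1)] and
    [(n + 2 beta) a_(n+1)]; one application of the Schwarz lemma replaces it by
    [w / z], the function to which Schur's algorithm is applied. *)
Lemma starlike_bound alpha f a :
  0 <= alpha < 1 -> starlike_of_order alpha f -> taylor_coefficients f a ->
  Cmod (hankel_2_2 a) <= (1 - alpha) ^ 2.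
Proof.
  intros Halpha ((_ & Hf0 & Hf1) & Hnz & Hre) Hf.
  assert (Hd := taylor_C_derive f a Hf).
  assert (Ha0 : a 0%nat = RtoC 0) by (rewrite <- (taylor_at_0 f a Hf); auto).
  assert (Ha1 : a 1%nat = RtoC 1).
  { rewrite <- Hf1, (taylor_at_0 _ _ Hd). simpl. ring. }
  destruct (taylor_shift f a Hf Ha0) as (F & HF & HfF).
  assert (HF0 : forall z, unit_disk z -> F z <> RtoC 0).
  { intros z Hz H. destruct (Ceq_dec z (RtoC 0)) as [->|Hz0].
    - rewrite (taylor_at_0 _ _ HF), Ha1 in H. apply RtoC_inj in H. lra.
    - apply (Hnz z Hz Hz0). rewrite (HfF z Hz), H. ring. }
  set (beta := 1 - alpha).
  assert (HA := taylor_lin _ _ _ _ (- RtoC 1)%C Hd HF).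
  assert (HB := taylor_lin _ _ _ _ (RtoC (2 * beta - 1))%C Hd HF).
  cbv beta in HA, HB.
  (* the quotient [p = z f' / f] is [f' / F] at every point, including zero *)
  assert (Hp : forall z, unit_disk z -> exists p, alpha < Re p /\ C_derive f z = (p * F z)%C).
  { intros z Hz. specialize (Hre z Hz). unfold starlike_quotient in Hre.
    destruct (Ceq_dec z (RtoC 0)) as [->|Hz0].
    - exists (RtoC 1). split; auto.
      rewrite (taylor_at_0 _ _ HF), Hf1, Ha1. ring.
    - eexists. split; [exact Hre|]. rewrite (HfF z Hz). field. auto. }
  assert (HB0 : forall z, unit_disk z ->
    (C_derive f z + RtoC (2 * beta - 1) * F z)%C <> RtoC 0).
  { intros z Hz. destruct (Hp z Hz) as (p & Hrep & Hpz). rewrite Hpz.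
    replace (p * F z + RtoC (2 * beta - 1) * F z)%C
      with ((p + RtoC (2 * beta - 1)) * F z)%C by ring.
    apply Cmult_neq_0; auto. intros H. apply (f_equal fst) in H.
    unfold Re in Hrep. simpl in H. unfold beta in H. lra. }
  destruct (schwarz _ _ _ _ 1 HA HB) as (W & HW & HWle); auto.
  { rewrite Ha1. simpl. ring. }
  { intros z Hz. destruct (Hp z Hz) as (p & Hrep & Hpz). rewrite Hpz, Rmult_1_l.
    replace (p * F z + - RtoC 1 * F z)%C with ((p - RtoC 1) * F z)%C by ring.
    replace (p * F z + RtoC (2 * beta - 1) * F z)%C
      with ((p + RtoC (2 * beta - 1)) * F z)%C by ring.
    rewrite !Cmod_mult. apply Rmult_le_compat_r; [apply Cmod_ge_0|].
    apply Rsqr_incr_0_var; [|apply Cmod_ge_0]. rewrite !Rsqr_pow2, !Cmod2.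
    destruct p as [x y]. simpl in *. unfold beta. nra. }
  assert (Hbeta : 0 < beta <= 1) by (unfold beta; lra).
  assert (Hbeta' : RtoC beta <> RtoC 0) by (intros H; apply RtoC_inj in H; lra).
  set (w1 := (a 2%nat / (RtoC 2 * RtoC beta))%C).
  set (w2 := ((a 3%nat - RtoC beta * (RtoC 1 + RtoC 2 * RtoC beta) * w1 * w1)
              / RtoC beta)%C).
  set (w3 := ((RtoC 3 * a 4%nat - w1 * (RtoC 2 + RtoC 2 * RtoC beta) * a 3%nat
               - w2 * (RtoC 1 + RtoC 2 * RtoC beta) * a 2%nat)
              / (RtoC 2 * RtoC beta))%C).
  assert (H2 : RtoC 2 <> RtoC 0) by (intros H; apply RtoC_inj in H; lra).
  assert (H3 : RtoC 3 <> RtoC 0) by (intros H; apply RtoC_inj in H; lra).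
  assert (Ha2 : a 2%nat = (RtoC 2 * RtoC beta * w1)%C) by (unfold w1; field; auto).
  assert (Ha3 : a 3%nat = (RtoC beta * w2
     + RtoC beta * (RtoC 1 + RtoC 2 * RtoC beta) * w1 * w1)%C).
  { unfold w2. field. auto. }
  assert (Ha4 : (RtoC 3 * a 4%nat)%C = (w1 * (RtoC 2 + RtoC 2 * RtoC beta) * a 3%nat
     + w2 * (RtoC 1 + RtoC 2 * RtoC beta) * a 2%nat + w3 * (RtoC 2 * RtoC beta))%C).
  { unfold w3. field. auto. }
  assert (I1 : forall n, RtoC (INR (S n)) = (RtoC (INR n) + RtoC 1)%C).
  { intros n. now rewrite S_INR, RtoC_plus. }
  assert (I0 : RtoC (INR 0) = RtoC 0) by reflexivity.
  assert (I2 : RtoC 2 = (RtoC 1 + RtoC 1)%C) by (rewrite <- RtoC_plus; f_equal; lra).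
  assert (I3 : RtoC 3 = (RtoC 1 + RtoC 1 + RtoC 1)%C)
    by (rewrite <- !RtoC_plus; f_equal; lra).
  assert (Hk : Rabs (1 - 4 * beta ^ 2) <= 3) by (apply Rabs_le; nra).
  (* Schur's algorithm applies to [t w], which is bounded by [t < 1] *)
  assert (Hfun : Cmod ((RtoC 4 * w1 * w3 - RtoC 3 * w2 * w2)
     + RtoC 2 * w1 * w1 * w2 + RtoC (1 - 4 * beta ^ 2) * w1 * w1 * w1 * w1) <= 3).
  { apply Cmod_limit_bound. intros t Ht.
    assert (HtW := taylor_lin _ _ _ _ (RtoC t - RtoC 1)%C HW HW).
    destruct (schur_parameters _ _ _ _ t (RtoC t * w1) (RtoC t * w2) (RtoC t * w3) HtW HB)
      as (Hw & x & zeta & Hx & Hz & E1 & E2); auto; try lra.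
    - intros z Hz. cbv beta.
      replace (W z + (RtoC t - RtoC 1) * W z)%C with (RtoC t * W z)%C by ring.
      rewrite Cmod_mult, Cmod_R, Rabs_pos_eq by lra.
      apply Rmult_le_compat_l; [lra|].
      specialize (HWle z Hz). rewrite Rmult_1_l in HWle. exact HWle.
    - cbv beta. rewrite Ha1, Ha2, RtoC_minus, RtoC_mult, !I1, I0, I2. ring.
    - cbv beta. rewrite Ha1, Ha3, Ha2, RtoC_minus, RtoC_mult, !I1, I0, I2. ring.
    - cbv beta. rewrite Ha1.
      transitivity (RtoC t * (RtoC 3 * a 4%nat))%C.
      + rewrite !I1, I0, I3. ring.
      + rewrite Ha4, RtoC_minus, RtoC_mult, !I1, I0, I2. ring.
    - assert (Hb := schur_functional_bound _ _ _ _ _ _ Hk Hw Hx Hz E1 E2).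
      eapply Rle_trans; [right|exact Hb]. f_equal. rewrite !RtoC_pow. ring. }
  assert (H : (RtoC 3 * hankel_2_2 a)%C = (RtoC (beta ^ 2)
     * ((RtoC 4 * w1 * w3 - RtoC 3 * w2 * w2)
     + RtoC 2 * w1 * w1 * w2 + RtoC (1 - 4 * beta ^ 2) * w1 * w1 * w1 * w1))%C).
  { unfold hankel_2_2.
    transitivity (a 2%nat * (RtoC 3 * a 4%nat) - RtoC 3 * a 3%nat * a 3%nat)%C; [ring|].
    rewrite Ha4, Ha3, Ha2, RtoC_minus, RtoC_mult, !RtoC_pow.
    replace (RtoC 4) with (RtoC 2 * RtoC 2)%C by (rewrite <- RtoC_mult; f_equal; lra).
    rewrite I3, I2. ring. }
  apply (f_equal Cmod) in H. rewrite !Cmod_mult, !Cmod_R in H.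
  assert (Hb2 : 0 <= beta ^ 2) by nra.
  rewrite (Rabs_pos_eq 3), (Rabs_pos_eq (beta ^ 2)) in H by lra.
  fold beta.
  apply Rmult_le_reg_l with 3; [lra|]. rewrite H, (Rmult_comm 3).
  now apply Rmult_le_compat_l.
Qed.

(** * Sharpness *)

(** Taylor coefficients of the extremal function [z / (1 - z^2)^beta]. *)
Fixpoint extremal_coef (beta : R) (n : nat) : R :=
  match n with
  | 0%nat => 0
  | 1%nat => 1
  | S (S m) => extremal_coef beta m * ((INR m - 1 + 2 * beta) / (INR m + 1))
  end.

Lemma extremal_coef_SS beta n :
  (INR n + 1) * extremal_coef beta (S (S n)) =
  (INR n - 1 + 2 * beta) * extremal_coef beta n.
Proof. simpl. field. assert (H := pos_INR n). lra. Qed.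

Lemma extremal_coef_bounds beta : 0 < beta <= 1 -> forall n,
  0 <= extremal_coef beta n <= 1 /\
  extremal_coef beta (S (S n)) <= extremal_coef beta n.
Proof.
  intros Hb.
  assert (Hstep : forall n, 0 <= extremal_coef beta n ->
    0 <= extremal_coef beta (S (S n)) <= extremal_coef beta n).
  { intros [|n] H; [simpl; lra|].
    assert (Hn := pos_INR n).
    assert (Hq : 0 <= (INR (S n) - 1 + 2 * beta) / (INR (S n) + 1) <= 1).
    { rewrite S_INR. split; [apply Rdiv_le_0_compat; lra|].
      apply Rle_div_l; lra. }
    change (extremal_coef beta (S (S (S n)))) with (extremal_coef beta (S n) *
      ((INR (S n) - 1 + 2 * beta) / (INR (S n) + 1))).
    nra. }
  assert (Hall : forall n, (0 <= extremal_coef beta n <= 1) /\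
    (0 <= extremal_coef beta (S n) <= 1)).
  { induction n as [|n [IH1 IH2]]; [simpl; lra|].
    split; auto. specialize (Hstep n (proj1 IH1)). lra. }
  intros n. destruct (Hall n) as [H _]. split; auto. now apply Hstep.
Qed.

Lemma extremal_coef_telescope beta n :
  sum_n (fun k => extremal_coef beta (S k) - extremal_coef beta (S (S (S k)))) n =
  1 - extremal_coef beta (S (S n)) - extremal_coef beta (S (S (S n))).
Proof.
  induction n as [|n IH].
  - rewrite sum_O. simpl. lra.
  - rewrite sum_Sn, IH. unfold plus. cbn [AbelianMonoid.plus]. simpl. lra.
Qed.

Lemma Re_mobius_gt (v : C) : Cmod v < 1 -> - (1 / 2) < Re (v / (RtoC 1 - v)).
Proof.
  intros Hv. assert (H : Cmod v ^ 2 < 1) by (assert (H := Cmod_ge_0 v); nra).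
  rewrite Cmod2 in H. destruct v as [x y]. unfold Re, Cdiv, Cinv. simpl in *.
  set (D := (1 + - x) * ((1 + - x) * 1) + (0 + - y) * ((0 + - y) * 1)).
  assert (HD : 0 < D) by (unfold D; nra).
  match goal with |- _ < ?X => replace X with ((x * (1 - x) - y ^ 2) / D)
    by (unfold D; field; unfold D in HD; lra) end.
  apply Rlt_div_r; auto. unfold D. nra.
Qed.

(** The recursion for the coefficients [a] is the differential equation
    [z f' (1 - z^2) = f (1 - z^2 + 2 beta z^2)], that is,
    [z f' / f = 1 + 2 beta z^2 / (1 - z^2)].  As [a] decreases with step two,
    [(1 - z^2) f = z + z^3 q] with [|q| <= sum_n (a_(n+1) - a_(n+3)) <= 1], so
    [f] has no zero but the origin. *)
Lemma extremal_function alpha : 0 <= alpha < 1 ->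
  exists f, starlike_of_order alpha f /\
    taylor_coefficients f (fun n => RtoC (extremal_coef (1 - alpha) n)).
Proof.
  intros Halpha. set (beta := 1 - alpha).
  assert (Hbeta : 0 < beta <= 1) by (unfold beta; lra).
  assert (Hbd := extremal_coef_bounds beta Hbeta).
  set (a := fun n => RtoC (extremal_coef beta n)).
  assert (Ha : subexponential a).
  { intros r Hr. exists (1 * 1). intros n. unfold a. rewrite Cmod_R.
    destruct (Hbd n) as [H _]. rewrite Rabs_pos_eq by lra.
    apply Rmult_le_compat; try lra; [apply pow_le; lra|].
    rewrite <- (pow1 n). apply pow_incr. lra. }
  destruct (subexponential_taylor a Ha) as [f Hf].
  assert (Hd := taylor_C_derive f a Hf).
  assert (Ha0 : a 0%nat = RtoC 0) by reflexivity.
  assert (Ha1 : a 1%nat = RtoC 1) by reflexivity.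
  assert (Ha2 : a 2%nat = RtoC 0) by (unfold a; simpl; f_equal; ring).
  assert (Hone : forall z, unit_disk z -> (RtoC 1 - z * z)%C <> RtoC 0).
  { intros z Hz H. unfold unit_disk in Hz.
    assert (H' : (z * z)%C = RtoC 1) by (transitivity (RtoC 1 - (RtoC 1 - z * z))%C; [ring|rewrite H; ring]).
    apply (f_equal Cmod) in H'. rewrite Cmod_mult, Cmod_1 in H'.
    assert (H0 := Cmod_ge_0 z). nra. }
  (* the series [q] in [(1 - z^2) f = z + z^3 q] *)
  destruct (subexponential_taylor (fun n => a (S (S (S n))) + - RtoC 1 * a (S n))%C)
    as [q Hq].
  { apply subexponential_le with (fun _ => RtoC 1).
    - intros n. unfold a. rewrite Cmod_1, <- RtoC_opp, <- RtoC_mult, <- RtoC_plus, Cmod_R.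
      destruct (Hbd (S n)) as [H1 H2]. destruct (Hbd (S (S (S n)))) as [H3 _].
      apply Rabs_le. lra.
    - intros r Hr. exists (1 * 1). intros n. rewrite Cmod_1.
      apply Rmult_le_compat_l; [lra|]. rewrite <- (pow1 n). apply pow_incr. lra. }
  assert (Hfq : forall z, unit_disk z ->
    ((RtoC 1 - z * z) * f z)%C = (z + z * z * z * q z)%C).
  { intros z Hz.
    assert (H1 := Hq z Hz).
    assert (H2 := is_pseries_cons (fun n => a (S (S n)) + - RtoC 1 * a n)%C z _ H1).
    assert (H3 : is_pseries (fun n => a (S (S n))) z
      ((a 2%nat + - RtoC 1 * a 0%nat + z * q z) + f z)%C).
    { generalize (is_pseries_lin _ _ (RtoC 1) z _ _ H2 (Hf z Hz)).
      rewrite Cmult_1_l. apply is_series_ext. intros n. f_equal.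
      ring. }
    assert (H4 := is_pseries_cons (fun n => a (S n)) z _ H3).
    assert (H5 := is_pseries_cons a z _ H4).
    assert (E := is_pseries_C_unique _ _ _ _ H5 (Hf z Hz)).
    cbv beta in E. rewrite Ha0, Ha1, Ha2 in E.
    transitivity (f z - z * z * f z)%C; [ring|]. rewrite <- E at 1. ring. }
  assert (Hq1 : forall z, unit_disk z -> Cmod (q z) <= 1).
  { intros z Hz. specialize (Hq z Hz). apply is_pseries_iff in Hq.
    apply Cmod_lim_le with (1 := Hq). intros n.
    eapply Rle_trans; [apply Cmod_partial_sum_le|].
    apply Rle_trans with
      (sum_n (fun k => extremal_coef beta (S k) - extremal_coef beta (S (S (S k)))) n).
    - rewrite !sum_n_Reals. apply sum_Rle. intros k _. unfold a.
      rewrite <- RtoC_opp, <- RtoC_mult, <- RtoC_plus, Cmod_R.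
      destruct (Hbd (S k)) as [_ H]. rewrite Rabs_left1 by (lra).
      assert (Hp : Cmod z ^ k <= 1).
      { rewrite <- (pow1 k). apply pow_incr. split; [apply Cmod_ge_0|now left]. }
      nra.
    - rewrite extremal_coef_telescope.
      destruct (Hbd (S (S n))) as [H1 _]. destruct (Hbd (S (S (S n)))) as [H2 _]. lra. }
  assert (Hnz : forall z, unit_disk z -> z <> RtoC 0 -> f z <> RtoC 0).
  { intros z Hz Hz0 H. specialize (Hfq z Hz). rewrite H, Cmult_0_r in Hfq.
    assert (E : z = (- (z * z * z * q z))%C).
    { transitivity ((z + z * z * z * q z) - z * z * z * q z)%C; [ring|].
      rewrite <- Hfq. ring. }
    apply (f_equal Cmod) in E. rewrite Cmod_opp, !Cmod_mult in E.
    specialize (Hq1 z Hz). apply Cmod_gt_0 in Hz0. unfold unit_disk in Hz.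
    assert (H0 := Cmod_ge_0 (q z)).
    assert (Cmod z * Cmod z < 1) by nra.
    assert (Cmod z * Cmod z * Cmod (q z) < 1) by nra. nra. }
  assert (Hode : forall z, unit_disk z ->
    (z * C_derive f z - f z)%C =
    (z * z * (z * C_derive f z + RtoC (2 * beta - 1) * f z))%C).
  { intros z Hz.
    assert (H1 := is_pseries_cons (fun n => RtoC (INR n) * a n)%C z _ (Hd z Hz)).
    assert (H2 := is_pseries_lin _ _ (RtoC (2 * beta - 1)) z _ _ H1 (Hf z Hz)).
    assert (H3 := is_pseries_lin _ _ (- RtoC 1)%C z _ _ H1 (Hf z Hz)).
    set (e := fun n => (RtoC (INR n) * a n + - RtoC 1 * a n)%C) in H3.
    assert (H4 : is_pseries (fun n => e (S (S n))) z
       (RtoC (INR 0) * a 0%nat + z * C_derive f z + RtoC (2 * beta - 1) * f z)%C).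
    { revert H2. apply is_series_ext. intros n. f_equal. unfold e, a.
      rewrite <- !RtoC_opp, <- !RtoC_mult, <- !RtoC_plus. f_equal.
      assert (E := extremal_coef_SS beta n). rewrite !S_INR. lra. }
    assert (H5 := is_pseries_cons (fun n => e (S n)) z _ H4).
    assert (H6 := is_pseries_cons e z _ H5).
    assert (E := is_pseries_C_unique _ _ _ _ H6 H3).
    unfold e in E. rewrite Ha0, Ha1 in E. simpl INR in E.
    transitivity (RtoC 0 * RtoC 0 + z * C_derive f z + - RtoC 1 * f z)%C; [ring|].
    rewrite <- E. ring. }
  exists f. split; [|exact Hf]. split; [|split; [exact Hnz|]].
  - split; [|split].
    + intros z Hz. destruct (taylor_is_derive f a z Hf Hz) as (l & Hl & _). now exists l.
    + now rewrite (taylor_at_0 f a Hf).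
    + rewrite (taylor_at_0 _ _ Hd), Ha1. simpl. ring.
  - intros z Hz. unfold starlike_quotient. destruct (Ceq_dec z (RtoC 0)) as [_|Hz0].
    + simpl. lra.
    + assert (Hv : Cmod (z * z) < 1).
      { rewrite Cmod_mult. unfold unit_disk in Hz. assert (H := Cmod_ge_0 z). nra. }
      assert (Hm := Re_mobius_gt _ Hv).
      replace (z * C_derive f z / f z)%C
        with (RtoC 1 + RtoC (2 * beta) * ((z * z) / (RtoC 1 - z * z)))%C.
      * rewrite re_plus, re_RtoC, re_scal_l. unfold beta in *. nra.
      * assert (Hfz := Hnz z Hz Hz0). assert (H1 := Hone z Hz). specialize (Hode z Hz).
        assert (E : (z * C_derive f z * (RtoC 1 - z * z))%C =
          ((RtoC 1 - z * z + RtoC (2 * beta) * (z * z)) * f z)%C).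
        { rewrite RtoC_minus in Hode.
          transitivity ((z * C_derive f z - f z) + f z - z * z * (z * C_derive f z))%C; [ring|].
          rewrite Hode. ring. }
        transitivity ((z * C_derive f z * (RtoC 1 - z * z)) / ((RtoC 1 - z * z) * f z))%C.
        -- rewrite E. field. auto.
        -- field. auto.
Qed.

Theorem theorem1 :
  forall alpha : R, 0 <= alpha < 1 ->
    (forall (f : C -> C) (a : nat -> C),
        starlike_of_order alpha f -> taylor_coefficients f a ->
        Cmod (hankel_2_2 a) <= (1 - alpha) ^ 2) /\
    (forall M : R,
        (forall (f : C -> C) (a : nat -> C),
            starlike_of_order alpha f -> taylor_coefficients f a ->
            Cmod (hankel_2_2 a) <= M) ->
        (1 - alpha) ^ 2 <= M).
Proof.
  intros alpha Halpha. split.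
  - intros f a. now apply starlike_bound.
  - intros M HM. destruct (extremal_function alpha Halpha) as (f & Hf & Ha).
    specialize (HM f _ Hf Ha). unfold hankel_2_2 in HM.
    rewrite <- RtoC_pow, <- RtoC_mult, <- RtoC_minus, Cmod_R in HM.
    eapply Rle_trans; [|exact HM]. rewrite <- Rabs_Ropp.
    eapply Rle_trans; [|apply Rle_abs]. right. simpl. field.
Qed.
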